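(* Let $0<s<\infty$ and let $(X,\mathscr{B},\mu,\rho)$ be a compact Ahlfors $s$-regular probability space. Let $\{B_n\}_{n\ge1}$ be a sequence of balls in $X$ with $\operatorname{diam} B_n$ decreasing to $0$ as $n\to\infty$. For each $n\ge1$ let $E_n$ be a nonempty open subset of $B_n$, and let \[\lambda=\sup\Big\{t\ge0\colon \sup_{n\ge1}\frac{I_t(\mu,E_n)\,\mu(B_n)}{\mu(E_n)^2}<\infty\Big\}.\] Assume $\lambda>0$. If $\mu\big(\limsup_{n\to\infty}B_n\big)=1$, then $\limsup_{n\to\infty}E_n\in\mathcal{G}^{\lambda}(X)$.
   Context: For a metric space $(X,\rho)$, $B(x,r)=\{y\in X:\rho(x,y)<r\}$ and $\overline{B}(x,r)=\{y\in X:\rho(x,y)\le r\}$; a ball is an open ball $B(x,r)$ with given centre $x$ and radius $r>0$. $\mathscr{B}$ is the Borel $\sigma$-algebra. A Borel measure $\mu$ is Ahlfors $s$-regular ($0<s<\infty$) if there is $1\le C<\infty$ with $C^{-1}r^s\le\mu(B(x,r))\le Cr^s$ for all $x\in X$ and $0<r\le\operatorname{diam}X$. A compact Ahlfors $s$-regular probability space $(X,\mathscr{B},\mu,\rho)$ means: $(X,\rho)$ is a compact metric space and $\mu$ is an Ahlfors $s$-regular Borel probability measure on it; then $\tau:=\dim_{\rm H}X=s$. For $t\ge0$ and $U\in\mathscr{B}$, $I_t(\mu,U)=\int_U\int_U\rho(x,y)^{-t}\,d\mu(x)\,d\mu(y)\in[0,\infty]$. For sets $F_n$, $\limsup_{n\to\infty}F_n=\bigcap_{m\ge1}\bigcup_{n\ge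 m}F_n$. Generalized dyadic cubes: fix $0<b<1/3$ and put $c_1=\frac12-\frac{b}{1-b}$, $c_1'=\frac1{1-b}$. Fix a family of Borel sets $\{Q_{n,i}: n\in\mathbb{Z}, i\in\mathbb{N}_n\subset\mathbb{N}\}$ (which exists by a known theorem) such that: (1) $X=\bigcup_{i\in\mathbb{N}_n}Q_{n,i}$ for every $n$, the sets $Q_{n,i}$ with the same $n$ and distinct $i$ being disjoint; (2) for $n\ge m$, either $Q_{n,i}\cap Q_{m,j}=\varnothing$ or $Q_{n,i}\subset Q_{m,j}$; (3) for each $n,i$ there is $x_{n,i}\in X$ with $B(x_{n,i},c_1b^n)\subset Q_{n,i}\subset\overline{B}(x_{n,i},c_1'b^n)$; (4) there is $x_0\in X$ such that for every $n$ there is $i$ with $B(x_0,c_1b^n)\subset Q_{n,i}$; (5) $\{x_{n,i}\}_{i\in\mathbb{N}_n}\subset\{x_{n+1,i}\}_{i\in\mathbb{N}_{n+1}}$ for all $n$. Put $\mathcal{Q}_0=\{X\}$, $\mathcal{Q}_n=\{Q_{n,i}:i\in\mathbb{N}_n\}$ for $n\ge1$, and $\mathcal{Q}=\bigcup_{n\ge0}\mathcal{Q}_n$. Large intersection classes: for $0<t\le\tau$ and $F\subset X$ let $\mathscr{M}^t_\infty(F)=\inf\{\sum_{i}\mu(Q_i)^{t/\tau}: F\subset\bigcup_{i}Q_i,\ Q_i\in\mathcal{Q}\}$ (countable covers). $\mathcal{G}^t(X)$ is the class of all $G_\delta$ sets $F\subset X$ such that for every $0<t'<t$ and every $Q\in\mathcal{Q}$,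 $\mathscr{M}^{t'}_\infty(F\cap Q)=\mathscr{M}^{t'}_\infty(Q)$. *)

(* Defs.v *)
From HB Require Import structures.
From mathcomp Require Import all_boot all_order all_algebra.
From mathcomp Require Import all_classical all_reals all_analysis.
From mathcomp Require Import borel_hierarchy.
Set Implicit Arguments.
Unset Strict Implicit.
Unset Printing Implicit Defensive.
Import Order.TTheory GRing.Theory Num.Theory.
Import numFieldNormedType.Exports.
Local Open Scope classical_set_scope.
Local Open Scope ring_scope.

(* The two structures are not linked by the type: [borel] below says that the
   sigma-algebra is the one generated by the open sets. *)
#[short(type="measurableMetricType")]
HB.structure Definition MeasurableMetric (d : measure_display)
  (K : numDomainType) := { T of Measurable d T & Metric K T }.

Definition borel (d : measure_display) (R : realType)
    (X : measurableMetricType d R) : Prop :=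
  @measurable d X = <<s @open X >>.

(* Not the library's [closed_ball], which is the closure of the open ball. *)
Definition cball (R : realType) (X : metricType R) (x : X) (r : R) : set X :=
  [set y | mdist x y <= r].

(* The additional 0 only serves to give the empty set diameter 0. *)
Definition diam (R : realType) (X : metricType R) (A : set X) : \bar R :=
  ereal_sup (0%E |` [set (mdist xy.1 xy.2)%:E | xy in A `*` A]).

Definition ahlfors_regular (d : measure_display) (R : realType)
    (X : measurableMetricType d R) (s : R)
    (mu : {measure set X -> \bar R}) : Prop :=
  exists C : R, 1 <= C /\
    forall (x : X) (r : R), 0 < r -> (r%:E <= diam [set: X])%E ->
      ((C^-1 * r `^ s)%:E <= mu (ball x r) <= (C * r `^ s)%:E)%E.

(* Covers are families indexed by a subset of nat, so as to allow finite (and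
   empty) covers along with countably infinite ones. *)
Definition hausdorff_premeasure (R : realType) (X : metricType R)
    (t delta : R) (A : set X) : \bar R :=
  ereal_inf [set (\esum_(i in JU.1) (diam (JU.2 i) `^ t))%E | JU in
    [set JU : set nat * (nat -> set X) |
      (forall i, JU.1 i -> (diam (JU.2 i) <= delta%:E)%E) /\
      A `<=` \bigcup_(i in JU.1) JU.2 i]].

Definition hausdorff_measure (R : realType) (X : metricType R)
    (t : R) (A : set X) : \bar R :=
  ereal_sup [set hausdorff_premeasure t delta A | delta in [set e : R | 0 < e]].

Definition hausdorff_dim (R : realType) (X : metricType R) (A : set X)
    : \bar R :=
  ereal_inf [set t%:E | t in
    [set t : R | 0 <= t /\ hausdorff_measure t A = 0%E]].

(* rho(x,y)^{-t} is the inverse in \bar R of rho(x,y)^t: it is +oo at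
   rho(x,y) = 0 when t > 0, whereas the real number 0 `^ (- t) is 0. *)
Definition energy (d : measure_display) (R : realType)
    (X : measurableMetricType d R) (mu : {measure set X -> \bar R})
    (t : R) (U : set X) : \bar R :=
  (\int[mu]_(y in U) \int[mu]_(x in U) ((mdist x y `^ t)%:E)^-1)%E.

(* N n is the set of indices of the cubes of generation n, ctr n i the centre
   x_{n,i}; the values of Q n and ctr n outside N n are irrelevant. *)
Record dyadic_cubes (d : measure_display) (R : realType)
    (X : measurableMetricType d R) (b : R) (N : int -> set nat)
    (Q : int -> nat -> set X) (ctr : int -> nat -> X) : Prop := DyadicCubes {
  cube_measurable : forall n i, N n i -> measurable (Q n i) ;
  cube_cover : forall n, \bigcup_(i in N n) Q n i = [set: X] ;
  cube_disjoint : forall n i j, N n i -> N n j -> i <> j ->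
    Q n i `&` Q n j = set0 ;
  cube_nested : forall n m i j, m <= n -> N n i -> N m j ->
    Q n i `&` Q m j = set0 \/ Q n i `<=` Q m j ;
  cube_ball : forall n i, N n i ->
    ball (ctr n i) ((2^-1 - b / (1 - b)) * b ^ n) `<=` Q n i /\
    Q n i `<=` cball (ctr n i) ((1 - b)^-1 * b ^ n) ;
  cube_origin : exists x0 : X, forall n, exists2 i, N n i &
    ball x0 ((2^-1 - b / (1 - b)) * b ^ n) `<=` Q n i ;
  cube_centers : forall n, ctr n @` N n `<=` ctr (n + 1) @` N (n + 1)
}.

(* X is the only member of generation 0, even if Q 0 has several cubes. *)
Definition cube_family (X : Type) (N : int -> set nat)
    (Q : int -> nat -> set X) : set (set X) :=
  [set A | A = setT \/
    exists n : nat, exists i : nat,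
      [/\ (0 < n)%N, N n%:Z i & A = Q n%:Z i]].

Definition cube_content (d : measure_display) (R : realType)
    (X : measurableMetricType d R) (mu : {measure set X -> \bar R})
    (QQ : set (set X)) (t : R) (F : set X) : \bar R :=
  ereal_inf [set
    (\esum_(i in JC.1) (mu (JC.2 i) `^ (t / fine (hausdorff_dim [set: X]))))%E
    | JC in [set JC : set nat * (nat -> set X) |
        (forall i, JC.1 i -> QQ (JC.2 i)) /\
        F `<=` \bigcup_(i in JC.1) JC.2 i]].

(* The index t is an extended real so that it can be a supremum in \bar R. *)
Definition large_intersection (d : measure_display) (R : realType)
    (X : measurableMetricType d R) (mu : {measure set X -> \bar R})
    (QQ : set (set X)) (t : \bar R) : set (set X) :=
  [set F | Gdelta F /\
    forall (t' : R) (A : set X), 0 < t' -> (t'%:E < t)%E -> QQ A ->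
      cube_content mu QQ t' (F `&` A) = cube_content mu QQ t' A].

Definition energy_exponent (d : measure_display) (R : realType)
    (X : measurableMetricType d R) (mu : {measure set X -> \bar R})
    (B E : nat -> set X) : \bar R :=
  ereal_sup [set t%:E | t in [set t : R | 0 <= t /\
    (ereal_sup (range (fun n : nat =>
       energy mu t (E n) * mu (B n) / (mu (E n) ^+ 2))) < +oo)%E]].

(* Main.v *)
Require Import Defs.
From HB Require Import structures.
From mathcomp Require Import all_boot all_order all_algebra.
From mathcomp Require Import all_classical all_reals all_analysis.
From mathcomp Require Import borel_hierarchy measurable_realfun.
From mathcomp Require Import ring lra.
Set Implicit Arguments.
Unset Strict Implicit.
Unset Printing Implicit Defensive.
Import Order.TTheory GRing.Theory Num.Theory.
Import numFieldNormedType.Exports.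
Local Open Scope classical_set_scope.
Local Open Scope ring_scope.

(** Write tau for the Hausdorff dimension of X, fix t below the exponent
lambda and put u = t / tau, so that the content of a set is the infimum of the
sums of mu(P)^u over its covers by cubes P.  The cube A alone covers A, at the
cost mu(A)^u.  The claim therefore follows once every cover of
limsup E_n intersected with A is shown to cost at least mu(A)^u, with constant
exactly 1.  Since s <= tau ([hausdorff_dim_ge]), s u <= t < lambda, so there is
t1 > s u for which the energy ratios of exponent t1 are bounded.

The idea is to avoid building a measure on limsup E_n.  The argument has four
steps.

One set at a time.  Splitting the energy integral of E_n along disjoint cubes
and applying the inequality between arithmetic and geometric means to each
piece gives mu(E)^2 <= K I_t(E) sum diam(P)^t for every cover of E by cubes
([energy_cover]).  With bounded energy ratios this says that every cover of
E_n has sum mu(P)^v >= mu(B_n) / K with v = t1 / s > u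
([energy_local_content]).  Covering by the cubes of a late generation shows
that v <= 1 ([local_content_exponent_le1]), hence u < 1.

From the sets to their union.  Take a cube A, and a cover of the union of those
E_n that lie in A and have a late index n.  If all cubes of the cover that meet
E_n stay near B_n, they are small, and the gain mu(P)^(v - u) makes
sum mu(P)^u at least mu(B_n) mu(A)^(u-1), up to a constant.  Otherwise some
cube of the cover is at least as large as B_n and a bounded enlargement of it
contains B_n.  As the balls B_n cover almost all of A, Vitali's covering lemma
bounds mu(A)^u by a constant times the sum ([inner_union_content_bound]).

The constant becomes 1.  A cover of this union in which no cube contains A
splits into covers of the unions attached to the children of A.  Since the
children are smaller than A by a fixed factor and u < 1, the sum of their
mu(P)^u exceeds mu(A)^u by a fixed factor larger than 1.  Any positive constant
can therefore be improved step by step up to 1 ([content_bound_improve]).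

From the unions to the limsup.  Suppose a family F of cubes costs less than
mu(A)^u.  With the constant 1 at hand, A contains some E_n of arbitrarily late
index, and this E_n contains the closure of a smaller cube in which F again
costs too little ([sparse_descend]); otherwise the maximal cubes in which F
costs enough would cover the union of the E_n at a total cost below mu(A)^u.
Iterating gives nested cubes whose common point lies in infinitely many E_n and
in no cube of F ([sparse_escape]). *)

(** * Sums over sets of cubes, and integrals of non-measurable functions *)

Section Sums.
Context {R : realType}.

Lemma esum_subset (T : choiceType) (A B : set T) (f : T -> \bar R) :
  (forall i, 0 <= f i)%E -> A `<=` B ->
  (\esum_(i in A) f i <= \esum_(i in B) f i)%E.
Proof.
move=> f0 AB; apply: ge_ereal_sup => _ [F [finF FA] <-].
by apply: esum_ge; exists F => //; split=> //; exact: subset_trans AB.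
Qed.

Lemma le_term_esum (T : choiceType) (A : set T) (f : T -> \bar R) i :
  (forall i, 0 <= f i)%E -> A i -> (f i <= \esum_(i in A) f i)%E.
Proof.
move=> f0 Ai; rewrite -(@esum_set1 R T i f)//.
by apply: esum_subset => // _ ->.
Qed.

Lemma esumZl (T : choiceType) (A : set T) (f : T -> \bar R) (c : R) :
  0 <= c -> (forall i, 0 <= f i)%E ->
  (\esum_(i in A) (c%:E * f i) = c%:E * \esum_(i in A) f i)%E.
Proof.
rewrite le_eqVlt => /predU1P[<-|c0] f0.
  by rewrite mul0e esum1// => i _; rewrite mul0e.
apply/eqP; rewrite eq_le; apply/andP; split.
  apply: ge_ereal_sup => _ [F [finF FA] <-].
  rewrite -ge0_mule_fsumr//; apply: lee_wpmul2l; first by rewrite lee_fin ltW.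
  by apply: esum_ge; exists F.
rewrite -lee_pdivlMl//; apply: ge_ereal_sup => _ [F [finF FA] <-].
rewrite lee_pdivlMl// ge0_mule_fsumr//.
by apply: esum_ge; exists F.
Qed.

(** Each element of C is counted at most once.  The pieces are indexed by an
arbitrary type because they will be families of cubes, indexed by cubes. *)
Lemma esum_disjoint_le (T U : choiceType) (A : set T) (B : T -> set U)
    (C : set U) (f : U -> \bar R) :
  (forall j, 0 <= f j)%E -> (forall i, A i -> B i `<=` C) ->
  (forall i i' j, A i -> A i' -> B i j -> B i' j -> i = i') ->
  (\esum_(i in A) \esum_(j in B i) f j <= \esum_(j in C) f j)%E.
Proof.
move=> f0 BC inj; rewrite esum_esum//.
rewrite -(esum_image _ (fun p : T * U => p.2) f); last first.
  move=> [i j] [i' j'] /set_mem[/= Ai Bij] /set_mem[/= Ai' Bij'] jj'.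
  move: jj' Bij' => <- Bij'; rewrite (inj i i' j)//.
by apply: esum_subset => // _ [[i j] [/= Ai Bij] <-]; exact: (BC i Ai).
Qed.

(** Passing from an indexed cover to the set of its members forgets repetitions,
which can only lower the sum. *)
Lemma esum_image_le (T U : choiceType) (A : set T) (g : T -> U)
    (f : U -> \bar R) :
  (forall j, 0 <= f j)%E ->
  (\esum_(j in g @` A) f j <= \esum_(i in A) f (g i))%E.
Proof.
move=> f0.
apply: (@le_trans _ _ (\esum_(j in g @` A)
    \esum_(i in A `&` [set i | g i = j]) f (g i))%E).
  apply: le_esum => _ [i Ai <-].
  by apply: (@le_term_esum _ _ (f \o g)) => //=; split.
apply: (@esum_disjoint_le _ _ _ _ _ (f \o g)) => //=.
by move=> j j' i _ _ [_ <-] [_ <-].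
Qed.

End Sums.

Section MeasureSums.
Context {d : measure_display} {R : realType} {X : measurableType d}.
Variable mu : {measure set X -> \bar R}.

Lemma measure_le_esum (I : choiceType) (A : set I) (F : I -> set X)
    (B : set X) :
  countable A -> (forall i, A i -> measurable (F i)) -> measurable B ->
  B `<=` \bigcup_(i in A) F i -> (mu B <= \esum_(i in A) mu (F i))%E.
Proof.
move=> /countable_injP[g ginj] mF mB BF.
pose G n := \bigcup_(i in A `&` [set i | g i = n]) F i.
have GE i : A i -> G (g i) = F i.
  move=> Ai; apply/seteqP; split=> [x [j [Aj gij] Fjx]|x Fix]; last first.
    by exists i.
  by have <- : j = i by apply: ginj; rewrite ?inE.
have mG n : measurable (G n).
  have [[i [Ai gi]]|nex] := pselect (exists i, A i /\ g i = n).
    by rewrite -gi GE//; exact: mF.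
  rewrite (_ : G n = set0)//; apply/seteqP; split=> // x [i [Ai gi] _].
  by case: nex; exists i.
have BG : B `<=` \bigcup_n G n.
  by move=> x /BF[i Ai Fix]; exists (g i) => //; rewrite GE.
apply: le_trans (measure_sigma_subadditive mu mG mB BG) _.
rewrite nneseries_esumT// (_ : \esum_(i in A) _ = \esum_(n in g @` A) mu (G n)).
  rewrite esum_mkcond [leRHS]esum_mkcond; apply: le_esum => n _.
  rewrite in_setT; case: ifPn => //; rewrite notin_setE /= => nA.
  rewrite (_ : G n = set0) ?measure0//.
  by apply/seteqP; split=> // x [i [Ai gi] _]; case: nA; exists i.
rewrite esum_image//.
by apply: eq_esum => i Ai; rewrite GE.
Qed.

(** The integral of a nonnegative function is a supremum over the simple functions
below it, so it is monotone without any measurability.  This makes it possible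
to bound the energy from below although measurability of the inner integral,
as a function of the outer variable, is never established. *)
Lemma ge0_le_integral_nonmeasurable (D : set X) (f g : X -> \bar R) :
  (forall x, D x -> (0 <= f x)%E) -> (forall x, D x -> (f x <= g x)%E) ->
  (\int[mu]_(x in D) f x <= \int[mu]_(x in D) g x)%E.
Proof.
move=> f0 fg.
have g0 x : D x -> (0 <= g x)%E by move=> Dx; exact: le_trans (f0 x Dx) (fg x Dx).
rewrite (ge0_integralE mu f0) (ge0_integralE mu g0).
apply: le_ereal_sup => _ [h /= hf <-]; exists h => //= x.
apply: le_trans (hf x) _; rewrite /patch; case: ifPn => // xD; exact/fg/set_mem.
Qed.

(** Each finite part of the sum is the integral of a simple function below f. *)
Lemma esum_measure_le_integral (I : choiceType) (A : set I) (F : I -> set X)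
    (c : I -> R) (D : set X) (f : X -> \bar R) :
  (forall i, A i -> measurable (F i)) -> (forall i, A i -> F i `<=` D) ->
  (forall i j x, A i -> A j -> F i x -> F j x -> i = j) ->
  measurable D ->
  (forall x, D x -> (0 <= f x)%E) ->
  (forall i, 0 <= c i) ->
  (forall i x, A i -> F i x -> ((c i)%:E <= f x)%E) ->
  (\esum_(i in A) ((c i)%:E * mu (F i)) <= \int[mu]_(x in D) f x)%E.
Proof.
move=> mF FD tF mD f0 c0 cf; apply: ge_ereal_sup => _ [S [finS SA] <-].
(* Outside S the sets are emptied, so that the terms are measurable for all i. *)
pose G i := if i \in S then F i else set0.
have GE i : S i -> G i = F i by move=> Si; rewrite /G mem_set.
have mG i : measurable (G i).
  by rewrite /G; case: ifPn => // iS; exact/mF/SA/set_mem.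
have GD i : G i `<=` D.
  rewrite /G; case: ifPn => [iS|_ x []//]; exact: (FD i (SA i (set_mem iS))).
rewrite [leLHS](_ : _ =
    \int[mu]_(x in D) (\sum_(i \in S) ((c i)%:E * (\1_(G i) x)%:E)%E))%E;
  last first.
  rewrite ge0_integral_fsum//.
    apply: eq_fsbigr => i /set_mem Si.
    rewrite ge0_integralZl ?lee_fin//.
    - by rewrite integral_indic// setIidl// GE.
    - exact/measurable_EFinP.
  - by move=> i; apply: emeasurable_funM => //; exact/measurable_EFinP.
  - by move=> i x _; rewrite -EFinM lee_fin mulr_ge0.
apply: ge0_le_integral_nonmeasurable => x Dx.
  by apply: fsume_ge0 => i _; rewrite -EFinM lee_fin mulr_ge0.
have [[i Si Fix]|nex] := pselect (exists2 i, S i & F i x).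
  rewrite (fsbigD1 i)//= fsbig1 ?adde0; last first.
    move=> j [Sj /= ji]; rewrite indicE memNset ?mule0// GE// => Fjx.
    by apply: ji; apply: (tF j i x) => //; exact: SA.
  by rewrite indicE GE// mem_set// mule1; apply: cf => //; exact: SA.
rewrite fsbig1; first exact: f0.
move=> i Si; rewrite indicE memNset ?mule0// GE// => Fix.
by apply: nex; exists i.
Qed.

Lemma esum_measure_le (I : choiceType) (A : set I) (F : I -> set X)
    (B : set X) :
  (forall i, A i -> measurable (F i)) -> (forall i, A i -> F i `<=` B) ->
  (forall i j x, A i -> A j -> F i x -> F j x -> i = j) ->
  measurable B ->
  (\esum_(i in A) mu (F i) <= mu B)%E.
Proof.
move=> mF FB tF mB; rewrite -[leRHS]mul1e -(integral_cst mu mB 1%E).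
rewrite (_ : \esum_(i in A) _ = \esum_(i in A) (1%:E * mu (F i)))%E; last first.
  by apply: eq_esum => i _; rewrite mul1e.
exact: (@esum_measure_le_integral _ _ _ (fun=> 1)).
Qed.

End MeasureSums.

(** * Trees of cubes of geometrically decreasing mass *)

(** Measures of measurable sets under a probability are finite; as real numbers
they can be raised to powers and compared by real arithmetic. *)
Definition mass {R : realType} {X : Type} (mu : set X -> \bar R) (P : set X)
  : R := fine (mu P).

(** The cost of the cube P in a content of exponent u. *)
Definition weight {R : realType} {X : Type} (mu : set X -> \bar R) (u : R)
  (P : set X) : R := mass mu P `^ u.

Definition members {X : Type} (D : nat -> set (set X)) : set (set X) :=
  \bigcup_k D k.

(** Cubes are nested or disjoint, so the maximal members of a family of cubes are
pairwise disjoint and have the same union as the family. *)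
Definition maximal_members {X : Type} (F : set (set X)) : set (set X) :=
  [set P | F P /\ forall Q, F Q -> P `<=` Q -> Q = P].

(** The combinatorial part of a system of dyadic cubes.  A set may belong to
several generations, since a cube may coincide with its only child.  Requiring
all masses of generation k to be comparable to q^k is what Ahlfors regularity
amounts to for cubes, q being b^s for cubes of diameter of order b^k. *)
Record mass_tree {d : measure_display} {R : realType} {X : measurableType d}
    (mu : set X -> \bar R) (D : nat -> set (set X)) (q m0 m1 : R)
    : Prop := MassTree {
  tree_ratio_gt0 : 0 < q ;
  tree_ratio_lt1 : q < 1 ;
  tree_lower_gt0 : 0 < m0 ;
  tree_upper_gt0 : 0 < m1 ;
  tree_measurable : forall k P, D k P -> measurable P ;
  tree_countable : forall k, countable (D k) ;
  tree_cover : forall k x, exists2 P, D k P & P x ;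
  tree_nested : forall k l P Q x, (l <= k)%N -> D k P -> D l Q ->
    P x -> Q x -> P `<=` Q ;
  tree_lower : forall k P, D k P -> m0 * q ^+ k <= mass mu P ;
  tree_upper : forall k P, D k P -> mass mu P <= m1 * q ^+ k
}.

Section Trees.
Context {d : measure_display} {R : realType} {X : measurableType d}.
Context {mu : probability X R}.

Lemma massE (P : set X) : measurable P -> mu P = (mass mu P)%:E.
Proof. by move=> mP; rewrite /mass fineK// fin_num_measure. Qed.

Lemma mass_ge0 (P : set X) : 0 <= mass mu P.
Proof. by rewrite fine_ge0. Qed.

Lemma mass_le1 (P : set X) : measurable P -> mass mu P <= 1.
Proof. by move=> mP; rewrite -lee_fin -massE// probability_le1. Qed.

Lemma le_mass (P Q : set X) : measurable P -> measurable Q -> P `<=` Q ->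
  mass mu P <= mass mu Q.
Proof.
by move=> mP mQ PQ; rewrite -lee_fin -!massE// le_measure ?inE.
Qed.

Lemma weight_ge0 (u : R) (P : set X) : 0 <= weight mu u P.
Proof. exact: powR_ge0. Qed.

Lemma le_weight (u : R) (P Q : set X) : 0 <= u -> measurable P ->
  measurable Q -> P `<=` Q -> weight mu u P <= weight mu u Q.
Proof.
move=> u0 mP mQ PQ; apply: ge0_ler_powR; rewrite ?nnegrE ?mass_ge0//.
exact: le_mass.
Qed.

Context {D : nat -> set (set X)} {q m0 m1 : R}.
Hypothesis tree : mass_tree mu D q m0 m1.

Lemma member_measurable (P : set X) : members D P -> measurable P.
Proof. by move=> [k _]; exact: (tree_measurable tree). Qed.

Lemma members_countable : countable (members D).
Proof.
by apply: bigcup_countable => // k _; exact: (tree_countable tree).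
Qed.

Lemma member_mass_gt0 (P : set X) : members D P -> 0 < mass mu P.
Proof.
move=> [k _ DP]; apply: lt_le_trans (tree_lower tree DP).
rewrite mulr_gt0 ?exprn_gt0 ?(tree_lower_gt0 tree)//.
exact: (tree_ratio_gt0 tree).
Qed.

Lemma member_nonempty (P : set X) : members D P -> P !=set0.
Proof.
move=> DP; apply/set0P/eqP => P0; have := member_mass_gt0 DP.
by rewrite P0 /mass measure0 ltxx.
Qed.

Lemma tree_disjoint k (P Q : set X) x : D k P -> D k Q -> P x -> Q x -> P = Q.
Proof.
move=> DP DQ Px Qx; apply/seteqP.
by split; apply: (@tree_nested _ _ _ _ _ _ _ _ tree k k) => //; eassumption.
Qed.

Lemma members_comparable (P Q : set X) x : members D P -> members D Q ->
  P x -> Q x -> P `<=` Q \/ Q `<=` P.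
Proof.
move=> [k _ DP] [l _ DQ] Px Qx; have [lk|kl] := leqP l k.
  by left; exact: (@tree_nested _ _ _ _ _ _ _ _ tree k l _ _ x).
by right; apply: (@tree_nested _ _ _ _ _ _ _ _ tree l k _ _ x) => //; exact: ltnW.
Qed.

Lemma tree_mass_small (e : R) : 0 < e ->
  exists k0, forall k P, (k0 <= k)%N -> D k P -> mass mu P < e.
Proof.
move=> e0; have q0 := tree_ratio_gt0 tree.
have q1 := tree_ratio_lt1 tree.
have m10 := tree_upper_gt0 tree.
have [k0 _ k0P] : \forall k \near \oo, m1 * q ^+ k < e.
  have /cvgrPdist_lt/(_ _ (divr_gt0 e0 m10)) :
      (fun k => q ^+ k) @ \oo --> (0 : R).
    by apply: cvg_expr; rewrite gtr0_norm.
  apply: filterS => k; rewrite sub0r normrN ger0_norm ?exprn_ge0 ?ltW//.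
  by rewrite ltr_pdivlMr// mulrC.
exists k0 => k P kk0 DP.
exact: le_lt_trans (tree_upper tree DP) (k0P k kk0).
Qed.

(** A member of F of the smallest possible generation among those containing P is
maximal, because a strictly larger cube would have a smaller generation. *)
Lemma maximal_members_cover (F : set (set X)) (P : set X) :
  F `<=` members D -> F P ->
  exists2 Q, maximal_members F Q & P `<=` Q.
Proof.
move=> FD FP.
pose S k := `[< exists2 Q, F Q & D k Q /\ P `<=` Q >].
have exS : exists k, S k.
  have [k _ DP] := FD _ FP; exists k; apply/asboolP; exists P => //.
  by split=> //; exact: subset_refl.
case: (ex_minnP exS) => k /asboolP[Q FQ [DQ PQ]] kmin.
exists Q => //; split=> // Q' FQ' QQ'; apply/seteqP; split=> //.
have [l _ DQ'] := FD _ FQ'.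
have [x Px] := member_nonempty (FD _ FP).
apply: (@tree_nested _ _ _ _ _ _ _ _ tree l k _ _ x) => //; [|exact/QQ'/PQ|exact: PQ].
by apply: kmin; apply/asboolP; exists Q' => //; split=> //; exact: subset_trans QQ'.
Qed.

Lemma maximal_members_disjoint (F : set (set X)) (P Q : set X) x :
  F `<=` members D -> maximal_members F P -> maximal_members F Q ->
  P x -> Q x -> P = Q.
Proof.
move=> FD [FP Pmax] [FQ Qmax] Px Qx.
have [PQ|QP] := members_comparable (FD _ FP) (FD _ FQ) Px Qx.
  exact/esym/Pmax.
exact: Qmax.
Qed.

(** A set which stays a cube of every later generation would have arbitrarily small
mass. *)
Lemma last_generation (A : set X) : members D A ->
  exists n, D n A /\ ~ D n.+1 A.
Proof.
move=> DA; have A0 := member_mass_gt0 DA; have [n _ DnA] := DA.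
apply: contrapT => /forallNP nlast.
have step m : D m A -> D m.+1 A.
  by move=> DmA; apply: contrapT => nDA; exact: (nlast m).
have DA' k : D (n + k)%N A.
  by elim: k => [|k IH]; rewrite ?addn0// addnS; exact: step.
have [k0 /(_ (n + k0)%N A (leq_addl _ _) (DA' _))] := tree_mass_small A0.
by rewrite ltxx.
Qed.

Lemma tree_bounds_ratio_lt1 (A : set X) : members D A -> m0 * q / m1 < 1.
Proof.
move=> [n _ DA].
have q0 := tree_ratio_gt0 tree.
have q1 := tree_ratio_lt1 tree.
have m00 := tree_lower_gt0 tree.
rewrite ltr_pdivrMr ?(tree_upper_gt0 tree)// mul1r.
apply: (@lt_le_trans _ _ m0); first by rewrite gtr_pMr.
rewrite -(@ler_pM2r _ (q ^+ n)) ?exprn_gt0//.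
exact: le_trans (tree_lower tree DA)
  (tree_upper tree DA).
Qed.

(** As A is not itself a cube of generation n + 1, it contains a second cube of
that generation, disjoint from P, which takes a fixed proportion of its mass. *)
Lemma child_mass_le (A P : set X) n x : D n A -> ~ D n.+1 A -> D n.+1 P ->
  A x -> P x -> mass mu P <= (1 - m0 * q / m1) * mass mu A.
Proof.
move=> DA nDA DP Ax Px.
have PA : P `<=` A := tree_nested tree (leqnSn n) DP DA Px Ax.
have [y Ay nPy] : exists2 y, A y & ~ P y.
  apply: contrapT => nex; apply: nDA; rewrite (_ : A = P)//.
  apply/seteqP; split=> // y Ay; apply: contrapT => nPy; apply: nex.
  by exists y.
have [P' DP' P'y] := tree_cover tree n.+1 y.
have P'A : P' `<=` A := tree_nested tree (leqnSn n) DP' DA P'y Ay.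
have mP := tree_measurable tree DP.
have mP' := tree_measurable tree DP'.
have mA := tree_measurable tree DA.
have PP' : P `&` P' = set0.
  apply/seteqP; split=> // z [Pz P'z]; apply: nPy.
  by rewrite (tree_disjoint DP DP' Pz P'z).
have add : mass mu P + mass mu P' <= mass mu A.
  rewrite -lee_fin EFinD -!massE// -measureU//.
  rewrite le_measure ?inE//; first exact: measurableU.
  by rewrite subUset.
have m10 := tree_upper_gt0 tree.
have q0 := tree_ratio_gt0 tree.
have m00 := tree_lower_gt0 tree.
have : m0 * q / m1 * mass mu A <= mass mu P'.
  apply: le_trans (tree_lower tree DP').
  apply: (@le_trans _ _ (m0 * q / m1 * (m1 * q ^+ n))).
    rewrite ler_pM2l; last by rewrite divr_gt0 ?mulr_gt0.
    exact: (tree_upper tree DA).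
  by rewrite mulrA divfK ?gt_eqF// -mulrA -exprS.
by rewrite mulrBl mul1r; lra.
Qed.

End Trees.

(** * Improving the constant in a lower bound for the content *)

Lemma powR_nincr {R : realType} (a b p : R) : 0 < a -> a <= b -> p <= 0 ->
  b `^ p <= a `^ p.
Proof.
move=> a0 ab; rewrite -oppr_ge0 => p0; have b0 := lt_le_trans a0 ab.
rewrite -[p]opprK [b `^ _]powRN [a `^ _]powRN lef_pV2 ?posrE ?powR_gt0//.
by apply: ge0_ler_powR; rewrite // nnegrE ltW.
Qed.

Definition family_weight {R : realType} {X : Type} (mu : set X -> \bar R)
  (u : R) (F : set (set X)) : \bar R := \esum_(P in F) (weight mu u P)%:E.

(** The set V A is to be thought of as the part of A that has to be covered; c is
the proportion of the cost of A that this requires at least. *)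
Definition content_bound {R : realType} {X : Type} (mu : set X -> \bar R)
    (D : nat -> set (set X)) (u : R) (V : set X -> set X) (c : R) : Prop :=
  forall (A : set X) (F : set (set X)), members D A -> F `<=` members D ->
    V A `<=` \bigcup_(P in F) P ->
    ((c * weight mu u A)%:E <= family_weight mu u F)%E.

Section Improvement.
Context {d : measure_display} {R : realType} {X : measurableType d}.
Context {mu : probability X R}.
Context {D : nat -> set (set X)} {q m0 m1 : R}.
Hypothesis tree : mass_tree mu D q m0 m1.

Let theta : R := 1 - m0 * q / m1.

Lemma weight_le_family (u : R) (A Q : set X) (F : set (set X)) : 0 <= u ->
  F `<=` members D -> members D A -> F Q -> A `<=` Q ->
  ((weight mu u A)%:E <= family_weight mu u F)%E.
Proof.
move=> u0 FD DA FQ AQ.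
apply: (@le_trans _ _ (weight mu u Q)%:E).
  by rewrite lee_fin le_weight//; apply: (member_measurable tree) => //; exact: FD.
rewrite /family_weight; apply: (@le_term_esum _ _ _ (fun P => (weight mu u P)%:E)) => //.
by move=> P; rewrite lee_fin weight_ge0.
Qed.

(** As u <= 1, the children P cost mu(P)^u = mu(P) mu(P)^(u-1), which is at least
mu(P) (theta mu(A))^(u-1); the masses of the children sum to that of A.  For
u < 1 and theta < 1 the total cost exceeds that of A by a factor larger
than 1. *)
Lemma children_weight (u : R) (A : set X) n : 0 < u -> u <= 1 ->
  D n A -> ~ D n.+1 A ->
  ((theta `^ (u - 1) * weight mu u A)%:E <=
   \esum_(P in [set P | D n.+1 P /\ P `&` A !=set0]) (weight mu u P)%:E)%E.
Proof.
move=> u0 u1 DA nDA.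
have memA : members D A by exists n.
have mA0 := member_mass_gt0 tree memA.
have thetaP P : (D n.+1 P /\ P `&` A !=set0) -> mass mu P <= theta * mass mu A.
  by move=> [DP [x [Px Ax]]]; exact: (child_mass_le tree DA nDA DP Ax Px).
have theta0 : 0 < theta.
  have [x Ax] := member_nonempty tree memA.
  have [P DP Px] := tree_cover tree n.+1 x.
  have PA : D n.+1 P /\ P `&` A !=set0 by split=> //; exists x.
  have P0 : 0 < mass mu P by apply: (member_mass_gt0 tree); exists n.+1.
  by rewrite -(pmulr_lgt0 _ mA0) (lt_le_trans P0)// thetaP.
have -> : theta `^ (u - 1) * weight mu u A =
    (theta * mass mu A) `^ (u - 1) * mass mu A.
  rewrite powRM ?ltW// -mulrA; congr (_ * _).
  by rewrite [RHS]mulrC mulr_powRB1// ltW.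
set Ch := [set P | _].
apply: (@le_trans _ _ (\esum_(P in Ch)
    (((theta * mass mu A) `^ (u - 1))%:E * mu P))%E); last first.
  apply: le_esum => P ChP; have DP : members D P by exists n.+1 => //; case: ChP.
  have P0 := member_mass_gt0 tree DP.
  rewrite (massE (member_measurable tree DP)) -EFinM lee_fin /weight.
  rewrite -(mulr_powRB1 (ltW P0) u0) mulrC ler_pM2l//.
  by apply: powR_nincr; rewrite ?subr_le0//; exact: thetaP.
rewrite esumZl ?powR_ge0// EFinM -(massE (member_measurable tree memA)).
apply: lee_wpmul2l; first by rewrite lee_fin powR_ge0.
apply: (@measure_le_esum _ _ _ _ _ _ id).
- by apply: sub_countable (tree_countable tree n.+1); apply: subset_card_le => P [].
- by move=> P [DP _]; exact: (tree_measurable tree DP).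
- exact: (member_measurable tree memA).
- move=> x Ax; have [P DP Px] := tree_cover tree n.+1 x.
  by exists P => //; split=> //; exists x.
Qed.

Section Step.
Variables (u : R) (V : set X -> set X).
Hypotheses (u0 : 0 < u) (u1 : u < 1).
Hypothesis V_sub : forall A, V A `<=` A.
Hypothesis V_mono : forall A B, A `<=` B -> V A `<=` V B.

(** Unless one member of F contains A, every member of F that meets A lies in a
single child of A, so the members meeting different children form disjoint
families, to which the bound with constant c applies. *)
Lemma content_bound_step (c : R) : 0 <= c -> content_bound mu D u V c ->
  content_bound mu D u V (Num.min 1 (c * theta `^ (u - 1))).
Proof.
move=> c0 bound A F DA FD VF.
have [[Q FQ AQ]|noQ] := pselect (exists2 Q, F Q & A `<=` Q).
  apply: le_trans (weight_le_family (ltW u0) FD DA FQ AQ).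
  by rewrite lee_fin ler_piMl ?weight_ge0// ge_min lexx.
have [n [DnA nDA]] := last_generation tree DA.
(* Generation n is the last one of A, so all its children are proper subsets. *)
set Ch := [set P | D n.+1 P /\ P `&` A !=set0].
have ChA P : Ch P -> P `<=` A.
  by move=> [DP [x [Px Ax]]]; exact: (tree_nested tree (leqnSn n) DP DnA Px Ax).
pose G P := F `&` [set Q | Q `&` P !=set0].
have GP P Q : Ch P -> G P Q -> Q `<=` P.
  move=> ChP [FQ [x [Qx Px]]]; have [l _ DQ] := FD _ FQ.
  have [ln|nl] := leqP l n.
    case: noQ; exists Q => //.
    exact: (tree_nested tree ln DnA DQ (ChA _ ChP _ Px) Qx).
  exact: (tree_nested tree nl DQ (proj1 ChP) Qx Px).
apply: (@le_trans _ _ (c%:E * (theta `^ (u - 1) * weight mu u A)%:E)%E).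
  by rewrite -EFinM lee_fin mulrA ler_wpM2r ?weight_ge0// ge_min lexx orbT.
apply: (@le_trans _ _ (c%:E * \esum_(P in Ch) (weight mu u P)%:E)%E).
  by apply: lee_wpmul2l; rewrite ?lee_fin//; apply: children_weight => //; exact: ltW.
rewrite -esumZl//; last by move=> P; rewrite lee_fin weight_ge0.
apply: (@le_trans _ _ (\esum_(P in Ch) \esum_(Q in G P) (weight mu u Q)%:E)%E).
  apply: le_esum => P ChP; rewrite -EFinM.
  apply: bound.
  - by exists n.+1 => //; case: ChP.
  - by move=> Q [/FD].
  - move=> x VPx; have [Q FQ Qx] := VF _ (V_mono (ChA _ ChP) VPx).
    by exists Q => //; split=> //; exists x; split=> //; exact: V_sub VPx.
apply: (@esum_disjoint_le _ _ _ _ _ _ (fun Q => (weight mu u Q)%:E)).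
- by move=> Q; rewrite lee_fin weight_ge0.
- by move=> P _ Q [].
- move=> P P' Q ChP ChP' GQ GQ'.
  have [x Qx] := member_nonempty tree (FD _ (proj1 GQ)).
  apply: (tree_disjoint tree (proj1 ChP) (proj1 ChP') (x := x)).
    exact: (GP _ _ ChP GQ).
  exact: (GP _ _ ChP' GQ').
Qed.

(** The factor theta^(u-1) > 1 can be gained repeatedly until the constant
reaches 1. *)
Lemma content_bound_improve (c : R) : 0 < c -> content_bound mu D u V c ->
  content_bound mu D u V 1.
Proof.
move=> c0 bound A F DA.
have mA0 := member_mass_gt0 tree DA.
have r1 := tree_bounds_ratio_lt1 tree DA.
have r0 : 0 < m0 * q / m1.
  by rewrite divr_gt0 ?mulr_gt0 ?(tree_upper_gt0 tree)
    ?(tree_ratio_gt0 tree) ?(tree_lower_gt0 tree).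
set g := theta `^ (u - 1).
have g1 : 1 < g.
  rewrite /g -[u - 1]opprB powRN invf_gt1 ?powR_gt0 ?subr_gt0//.
  have one : (1 : R) `^ (1 - u) = 1 by rewrite powR1.
  rewrite -[ltRHS]one; apply: gt0_ltr_powR; rewrite ?subr_gt0//.
  - by rewrite nnegrE subr_ge0 ltW.
  - by rewrite nnegrE.
  - by rewrite /theta gtrBl.
have iter k : content_bound mu D u V (Num.min 1 (c * g ^+ k)).
  elim: k => [|k IH].
    move=> A' F' DA' FD' VF'; apply: le_trans (bound A' F' DA' FD' VF').
    by rewrite lee_fin ler_wpM2r ?weight_ge0// expr0 mulr1 ge_min lexx orbT.
  move=> A' F' DA' FD' VF'.
  have mn0 : 0 <= Num.min 1 (c * g ^+ k).
    by rewrite le_min ler01 mulr_ge0 ?exprn_ge0 ?ltW// (lt_trans ltr01).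
  apply: le_trans (content_bound_step mn0 IH DA' FD' VF').
  rewrite lee_fin ler_wpM2r ?weight_ge0// le_min; apply/andP; split.
    by rewrite ge_min lexx.
  rewrite -/g; case: (leP 1 (c * g ^+ k)) => _; first by rewrite mul1r ge_min (ltW g1).
  by rewrite -mulrA -exprSr ge_min lexx orbT.
have [k ck] : exists k, 1 <= c * g ^+ k.
  have g0 : 0 < g := lt_trans ltr01 g1.
  have /cvgrPdist_lt/(_ _ c0)[k _ /(_ k (leqnn k))] :
      (fun k => g^-1 ^+ k) @ \oo --> (0 : R).
    by apply: cvg_expr; rewrite gtr0_norm ?invr_gt0// invf_lt1.
  rewrite sub0r normrN gtr0_norm ?exprn_gt0 ?invr_gt0// => gk.
  by exists k; rewrite -ler_pdivrMr ?exprn_gt0// div1r -exprVn ltW.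
by have := iter k A F DA; rewrite (min_idPl ck).
Qed.

End Step.
End Improvement.

(** * From unions of open sets to their upper limit *)

(** The sets E n are required to lie entirely in A, rather than intersected with
A, so that all the sets E n used inside a cube concern that cube only. *)
Definition inner_union {X : Type} (E : nat -> set X) (m : nat) (A : set X)
  : set X := \bigcup_(n in [set n | (m <= n)%N /\ E n `<=` A]) E n.

Definition meeting {X : Type} (F : set (set X)) (P : set X) : set (set X) :=
  F `&` [set Q | Q `&` P !=set0].

Section Descent.
Context {d : measure_display} {R : realType} {X : measurableMetricType d R}.
Context {mu : probability X R}.
Context {D : nat -> set (set X)} {q m0 m1 : R}.
Hypothesis tree : mass_tree mu D q m0 m1.
Variables (u : R) (E : nat -> set X).
Hypothesis u0 : 0 <= u.
Hypothesis X_compact : compact [set: X].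
Hypothesis E_bound : forall m, content_bound mu D u (inner_union E m) 1.
Hypothesis E_fine : forall n y, E n y ->
  exists P, [/\ members D P, P y & closure P `<=` E n].
Hypothesis E_small : forall e : R, 0 < e ->
  exists n0, forall n P, (n0 <= n)%N -> members D P -> P `<=` E n ->
    mass mu P < e.

Section Family.
Variable F : set (set X).
Hypothesis FD : F `<=` members D.

Let sparse P := members D P /\
  (family_weight mu u (meeting F P) < (weight mu u P)%:E)%E.

Lemma meeting_ge (P Q : set X) x : F Q -> Q x -> P x ->
  ((weight mu u Q)%:E <= family_weight mu u (meeting F P))%E.
Proof.
move=> FQ Qx Px; apply: (@le_term_esum _ _ _ (fun Q => (weight mu u Q)%:E)).
  by move=> ?; rewrite lee_fin weight_ge0.
by split=> //; exists x.
Qed.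

Lemma sparse_not_covered (P Q : set X) : sparse P -> F Q -> ~ (P `<=` Q).
Proof.
move=> [DP sP] FQ PQ; have [x Px] := member_nonempty tree DP.
move: sP; apply/negP; rewrite -leNgt.
apply: le_trans (meeting_ge FQ (PQ _ Px) Px); rewrite lee_fin.
by apply: le_weight => //; apply: (member_measurable tree) => //; exact: FD.
Qed.

(** Otherwise every cube P whose closure lies in such a set E n satisfies
weight P <= (sum of the weights of the members of F meeting P).  The maximal
cubes with this property inside A cover [inner_union E m A], so their weights
sum to at least that of A.  But each member of F meeting one of these maximal
cubes P is contained in P, as otherwise it would itself be a larger cube with
the property; hence the sums for distinct P involve disjoint parts of F, and F
would cost at least the weight of A inside A. *)
Lemma sparse_descend (A : set X) m : sparse A ->
  exists n P, [/\ (m <= n)%N, sparse P, closure P `<=` E n & E n `<=` A].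
Proof.
move=> sA; have [DA sumA] := sA; apply: contrapT => none.
pose dense_in := [set P | [/\ members D P, P `<=` A &
  ((weight mu u P)%:E <= family_weight mu u (meeting F P))%E]].
have dD : dense_in `<=` members D by move=> P [].
have VM : inner_union E m A `<=` \bigcup_(P in maximal_members dense_in) P.
  move=> y [n [mn EA] Ey]; have [P [DP Py clP]] := E_fine Ey.
  have [|Q MQ PQ] := maximal_members_cover tree (P := P) dD; last first.
    by exists Q => //; exact: PQ.
  split=> //; first by move=> z Pz; exact/EA/clP/subset_closure.
  rewrite leNgt; apply/negP => sP; apply: none; exists n, P.
  by split.
move: sumA; apply/negP; rewrite -leNgt -[weight mu u A]mul1r.
apply: le_trans (E_bound DA _ VM) _; first by move=> P [/dD].
apply: (@le_trans _ _ (\esum_(P in maximal_members dense_in)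
    \esum_(Q in meeting F P) (weight mu u Q)%:E)%E).
  by apply: le_esum => P [[]].
have inside P Q : maximal_members dense_in P -> meeting F P Q -> Q `<=` P.
  move=> [[DP PA _] Pmax] [FQ [x [Qx Px]]].
  have [//|PQ] := members_comparable tree (FD FQ) DP Qx Px.
  rewrite (Pmax Q)//; split; first exact: FD.
    have [//|AQ] := members_comparable tree (FD FQ) DA Qx (PA _ Px).
    by case: (sparse_not_covered sA FQ).
  exact: (meeting_ge FQ Qx Qx).
apply: (@esum_disjoint_le _ _ _ _ _ _ (fun Q => (weight mu u Q)%:E)).
- by move=> Q; rewrite lee_fin weight_ge0.
- move=> P [[_ PA _] _] Q [FQ [x [Qx Px]]]; split=> //.
  by exists x; split=> //; exact: PA.
- move=> P P' Q MP MP' GQ GQ'.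
  have [x Qx] := member_nonempty tree (FD (proj1 GQ)).
  apply: (maximal_members_disjoint tree dD MP MP' (x := x)).
    exact: (inside _ _ MP GQ).
  exact: (inside _ _ MP' GQ').
Qed.

(** The closures of the cubes produced by [sparse_descend] are nested in a compact
space, and each of them lies in some E n which lies in the previous cube; thus
a common point of the closures belongs to all the cubes.  A member of F through
this point would be contained in none of the cubes, because their masses tend
to 0, and contain none of them, because F is sparse in each. *)
Lemma sparse_escape (A : set X) : sparse A ->
  exists x, [/\ lim_sup_set E x, A x & forall Q, F Q -> ~ Q x].
Proof.
move=> sA.
have [f fP] : {f : set X * nat -> set X * nat & forall p, sparse p.1 ->
    [/\ (p.2 < (f p).2)%N, sparse (f p).1, closure (f p).1 `<=` E (f p).2 &
        E (f p).2 `<=` p.1]}.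
  apply: (@choice _ _ (fun p p' => sparse p.1 -> [/\ (p.2 < p'.2)%N, sparse p'.1,
    closure p'.1 `<=` E p'.2 & E p'.2 `<=` p.1])) => -[P n].
  have [sP|nsP] := pselect (sparse P); last by exists (P, n).
  have [k [Q [nk sQ clQ EP]]] := sparse_descend n.+1 sP.
  by exists (Q, k).
pose a k := iter k f (A, 0%N).
have sa k : sparse (a k).1 by elim: k => // k IH; case: (fP _ IH).
have step k := fP _ (sa k).
have ge_a k : (k <= (a k).2)%N.
  by elim: k => // k IH; apply: (leq_ltn_trans IH); case: (step k).
have sub_a j k : (j <= k)%N -> (a k).1 `<=` (a j).1.
  move=> /subnK <-; elim: (k - j)%N => // i IH; apply: subset_trans IH.
  have [_ _ cl sub] := step (i + j)%N.
  exact: subset_trans (subset_trans (@subset_closure _ _) cl) sub.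
have ne_a k : exists y, (a k).1 y.
  by have [DP _] := sa k; exact: (member_nonempty tree DP).
have [y yP] := choice ne_a.
have [|x [_ xcl]] := X_compact (F := y @ \oo); first exact: filterT.
have x_closure k : closure (a k).1 x.
  move=> B xB; apply: (xcl (a k).1 B) => //.
  by exists k => // j /= kj; exact/(sub_a k j kj)/yP.
have xa k : (a k).1 x.
  have [_ _ cl sub] := step k; exact/sub/cl/(x_closure k.+1).
exists x; split.
- move=> n _; exists (a n.+1).2; first exact: (leq_trans (leqnSn n) (ge_a _)).
  by have [_ _ cl _] := step n; exact/cl/(x_closure n.+1).
- exact: (xa 0%N).
- move=> Q FQ Qx; have DQ := FD FQ.
  have [n0 n0P] := E_small (member_mass_gt0 tree DQ).
  have [_ [Da _] cl _] := step n0.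
  have [|Qa] := members_comparable tree Da DQ (xa n0.+1) Qx.
    exact: (sparse_not_covered (sa n0.+1) FQ).
  have := n0P _ _ (leq_trans (leqnSn n0) (ge_a n0.+1)) Da
    (subset_trans (@subset_closure _ _) cl).
  by rewrite ltNge le_mass//; apply: (member_measurable tree).
Qed.

End Family.

Lemma limsup_weight_le (A : set X) (F : set (set X)) :
  members D A -> F `<=` members D ->
  lim_sup_set E `&` A `<=` \bigcup_(P in F) P ->
  ((weight mu u A)%:E <= family_weight mu u F)%E.
Proof.
move=> DA FD cov; rewrite leNgt; apply/negP => lt.
have [|x [Ex Ax nF]] := sparse_escape FD (A := A).
  split=> //; apply: le_lt_trans lt; apply: esum_subset => [Q|Q []//].
  by rewrite lee_fin weight_ge0.
by have [Q FQ Qx] := cov _ (conj Ex Ax); exact: (nF Q).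
Qed.

End Descent.

(** * Metric covering lemma and energy *)

Section Metric.
Context {R : realType} {X : metricType R}.

Lemma metric_ball_open (x : X) (r : R) : open (ball x r).
Proof.
rewrite openE => y; rewrite ballEmdist /= => xy; rewrite /interior.
apply/nbhs_ballP; exists (r - mdist x y) => /=; first by rewrite subr_gt0.
move=> z; rewrite !ballEmdist /= => yz.
by apply: le_lt_trans (metric_triangle x y z) _; rewrite -ltrBrDl.
Qed.

Lemma closure_sub_cball (x : X) (r : R) : closure (cball x r) `<=` cball x r.
Proof.
move=> y ycl; rewrite /cball /= leNgt; apply/negP => ry.
have e0 : 0 < mdist x y - r by rewrite subr_gt0.
have [z []] := ycl _ (nbhsx_ballx y _ e0).
rewrite /cball ballEmdist /= => xz yz.
have := metric_triangle x z y; rewrite (metric_sym z y); lra.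
Qed.

Lemma cball_closed (x : X) (r : R) : closed (cball x r).
Proof. by move=> y; exact: closure_sub_cball. Qed.

(** Greedy selection by decreasing radius: a ball that is discarded has its double
meeting the double of a selected ball of no smaller radius, whence the factor 5.
The doubled balls, not only the balls, are made disjoint. *)
Lemma vitali_finite (c : nat -> X) (r : nat -> R) (s : seq nat) :
  (forall n, 0 < r n) ->
  exists I : seq nat, [/\ {subset I <= s},
    forall i j x, i \in I -> j \in I ->
      ball (c i) (2 * r i) x -> ball (c j) (2 * r j) x -> i = j &
    forall n, n \in s -> exists2 j, j \in I &
      ball (c n) (r n) `<=` ball (c j) (5 * r j)].
Proof.
move=> r0; have [m] := ubnP (size s); elim: m s => // m IH s.
have [->|s0] := eqVneq s [::]; first by move=> _; exists [::]; split.
rewrite ltnS => sm.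
have [k ks kmax] : exists2 k, k \in s & forall n, n \in s -> r n <= r k.
  elim: s {IH sm} s0 => // n [|n' s] IHs _.
    by exists n; rewrite ?mem_head// => i; rewrite inE => /eqP ->.
  have [k ks kmax] := IHs isT.
  have [nk|kn] := leP (r n) (r k).
    exists k; first by rewrite inE ks orbT.
    by move=> i; rewrite inE => /predU1P[->//|/kmax].
  exists n; first by rewrite mem_head.
  move=> i; rewrite inE => /predU1P[->//|/kmax ik].
  exact: le_trans ik (ltW kn).
pose meets n := `[< exists x, ball (c n) (2 * r n) x /\ ball (c k) (2 * r k) x >].
have meetsk : meets k.
  apply/asboolP; exists (c k); rewrite !ballEmdist /= mdistxx.
  by rewrite mulr_gt0.
have [|I [Is Idis Icov]] := IH [seq n <- s | ~~ meets n].
  rewrite size_filter; apply: leq_trans sm.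
  rewrite -(count_predC meets s) -[ltnLHS]add0n ltn_add2r.
  by rewrite -has_count; apply/hasP; exists k.
exists (k :: I); split.
- move=> n; rewrite inE => /predU1P[->//|/Is].
  by rewrite mem_filter => /andP[].
- have Ik j x : j \in I -> ball (c j) (2 * r j) x -> ball (c k) (2 * r k) x -> False.
    move=> /Is; rewrite mem_filter => /andP[/negP nm _] xj xk.
    by apply: nm; apply/asboolP; exists x.
  move=> i j x; rewrite !inE => /predU1P[->|iI] /predU1P[->|jI]//.
  + by move=> xk xj; case: (Ik j x).
  + by move=> xi xk; case: (Ik i x).
  + exact: Idis.
- move=> n ns; have [nm|nm] := boolP (meets n).
    exists k; first by rewrite mem_head.
    have /asboolP[x []] := nm; rewrite !ballEmdist /= => nx kx y /= ny.
    have := metric_triangle (c k) x y; have := metric_triangle x (c n) y.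
    by rewrite (metric_sym x (c n)); have := kmax _ ns; lra.
  have [|j jI nj] := Icov n; first by rewrite mem_filter nm.
  by exists j => //; rewrite inE jI orbT.
Qed.

End Metric.

Section Energy.
Context {d : measure_display} {R : realType} {X : measurableMetricType d R}.
Context {mu : probability X R}.
Context {D : nat -> set (set X)} {q m0 m1 : R}.
Hypothesis tree : mass_tree mu D q m0 m1.

(** On the part of E in a cube P the kernel is at least the inverse of
w = K * weight P, so that the energy is at least the sum of the e_P^2 / w, where
e_P is the mass of the part of E in P.  Summing
e_P <= (a / 2) e_P^2 / w + w / (2 a) over disjoint cubes, with
a = mass E / I, gives the claim; this is the Cauchy-Schwarz inequality in a
form that only needs sums of nonnegative terms. *)
Lemma energy_cover (t v K I : R) (E : set X) (F : set (set X)) :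
  0 < K -> 0 < I ->
  (forall P x y, members D P -> P x -> P y ->
     mdist x y `^ t <= K * weight mu v P) ->
  measurable E -> (energy mu t E <= I%:E)%E ->
  F `<=` members D -> E `<=` \bigcup_(P in F) P ->
  ((mass mu E ^+ 2)%:E <= (K * I)%:E * family_weight mu v F)%E.
Proof.
move=> K0 I0 dist_le mE EI FD cov.
have w0 P : members D P -> 0 < weight mu v P.
  by move=> DP; rewrite powR_gt0// (member_mass_gt0 tree).
pose M := maximal_members F.
have MF : M `<=` F by move=> P [].
have MD : M `<=` members D := subset_trans MF FD.
have mM P : M P -> measurable (E `&` P).
  by move=> /MD DP; apply: measurableI => //; exact: (member_measurable tree).
have covM : E `<=` \bigcup_(P in M) (E `&` P).
  move=> x Ex; have [P FP Px] := cov _ Ex.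
  have [Q MQ PQ] := maximal_members_cover tree FD FP.
  by exists Q => //; split=> //; exact: PQ.
have [E0|E0] := leP (mass mu E) 0.
  have -> : mass mu E = 0 by apply/eqP; rewrite eq_le E0 mass_ge0.
  rewrite expr0n /=; apply: mule_ge0; first by rewrite lee_fin mulr_ge0 ?ltW.
  by apply: esum_ge0 => P _; rewrite lee_fin weight_ge0.
pose c P := mass mu (E `&` P) / (K * weight mu v P).
have c0 P : 0 <= c P by rewrite divr_ge0 ?mass_ge0// mulr_ge0 ?weight_ge0// ltW.
have kernel0 x y : (0 <= ((mdist x y `^ t)%:E)^-1)%E.
  by rewrite inve_ge0 lee_fin powR_ge0.
have sumc : (\esum_(P in M) ((c P)%:E * mu (E `&` P)) <= I%:E)%E.
  apply: le_trans EI; apply: esum_measure_le_integral => //.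
  - move=> P Q x MP MQ [_ Px] [_ Qx].
    exact: (maximal_members_disjoint tree FD MP MQ Px Qx).
  - by move=> y _; apply: integral_ge0 => x _.
  - move=> P y MP [Ey Py].
    have mEP := mM _ MP.
    apply: (@le_trans _ _ (\esum_(i in [set tt])
        (((K * weight mu v P)^-1)%:E * mu (E `&` P)))%E).
      rewrite esum_set1; last first.
        by rewrite mule_ge0// lee_fin invr_ge0 mulr_ge0 ?weight_ge0 ?ltW.
      by rewrite (massE mEP) -EFinM lee_fin mulrC.
    apply: (@esum_measure_le_integral _ _ _ _ _ _ _ (fun=> (K * weight mu v P)^-1)) => //.
    + by move=> [] [].
    + by move=> _; rewrite invr_ge0 mulr_ge0 ?weight_ge0 ?ltW.
    + move=> _ x _ [Ex Px]; have := dist_le P x y (MD _ MP) Px Py.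
      have := powR_ge0 (mdist x y) t; rewrite le_eqVlt => /predU1P[<- _|d0 dle].
        by rewrite inve0 leey.
      rewrite inver gt_eqF// lee_fin lef_pV2// posrE//.
      by rewrite mulr_gt0// w0//; exact: MD.
have WF : (family_weight mu v M <= family_weight mu v F)%E.
  by apply: esum_subset => // P; rewrite lee_fin weight_ge0.
(* The weight in the termwise inequality, optimal up to a factor 2. *)
have [a aE] : exists a, a = mass mu E / I by exists (mass mu E / I).
have a0 : 0 < a by rewrite aE divr_gt0.
have amgm P : M P -> (mu (E `&` P) <=
    (a / 2)%:E * ((c P)%:E * mu (E `&` P)) +
    (K / (2 * a))%:E * (weight mu v P)%:E)%E.
  move=> MP; rewrite (massE (mM _ MP)) -!EFinM -EFinD lee_fin /c.
  have wP := w0 _ (MD _ MP).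
  set w := weight mu v P in wP *; set e := mass mu _.
  rewrite -subr_ge0 (_ : _ - _ = (a * e - K * w) ^+ 2 / (2 * a * K * w)).
    by rewrite divr_ge0 ?sqr_ge0// ltW// !mulr_gt0.
  by field; rewrite !gt_eqF.
have key : ((mass mu E)%:E <= (a / 2 * I)%:E +
    (K / (2 * a))%:E * family_weight mu v F)%E.
  rewrite -(massE mE).
  have cM : countable M.
    by apply: sub_countable (members_countable tree); exact: subset_card_le.
  have h := @measure_le_esum _ _ _ mu _ M (fun P => E `&` P) E cM mM mE covM.
  apply: le_trans h _.
  apply: le_trans (le_esum amgm) _.
  rewrite esumD; last 2 first.
  - by move=> P _; rewrite mule_ge0 ?mule_ge0// lee_fin ?c0// divr_ge0// ltW.
  - by move=> P _; rewrite mule_ge0// lee_fin ?weight_ge0// divr_ge0 ?mulr_ge0// ltW.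
  rewrite !esumZl//; last 4 first.
  - by rewrite divr_ge0 ?mulr_ge0// ltW.
  - by move=> P; rewrite lee_fin weight_ge0.
  - by rewrite divr_ge0// ltW.
  - by move=> P; rewrite mule_ge0// lee_fin.
  rewrite (EFinM (a / 2)).
  by apply: leeD; apply: lee_wpmul2l => //; rewrite lee_fin divr_ge0 ?mulr_ge0// ltW.
have Wn0 : (0 <= family_weight mu v F)%E.
  by apply: esum_ge0 => P _; rewrite lee_fin weight_ge0.
move: key Wn0; case: (family_weight mu v F) => [W|_ _|//]; last first.
  by rewrite gt0_muley ?leey// lte_fin mulr_gt0.
rewrite -!EFinM -EFinD !lee_fin => key W0.
have e1 : a / 2 * I = mass mu E / 2 by rewrite aE; field; rewrite gt_eqF.
have e2 : K / (2 * a) * W = K * I * W / (2 * mass mu E).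
  by rewrite aE; field; rewrite !gt_eqF.
move: key; rewrite e1 e2 => key.
have : mass mu E / 2 <= K * I * W / (2 * mass mu E) by lra.
by rewrite ler_pdivlMr ?mulr_gt0// => h; rewrite expr2; lra.
Qed.

End Energy.

(** * From the single sets to their union *)

Section LocalToGlobal.
Context {d : measure_display} {R : realType} {X : measurableMetricType d R}.
Context {mu : probability X R}.
Context {D : nat -> set (set X)} {q m0 m1 : R}.
Hypothesis tree : mass_tree mu D q m0 m1.
Variables (s C c Delta L Kc : R).
Hypotheses (s0 : 0 < s) (C0 : 0 < C) (c0 : 0 < c) (Delta0 : 0 < Delta)
  (L0 : 0 < L) (Kc0 : 0 < Kc).
Hypothesis open_measurable : forall U : set X, open U -> measurable U.
Hypothesis ball_upper : forall (z : X) (e : R), 0 < e ->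
  mass mu (ball z e) <= C * e `^ s.
Hypothesis ball_lower : forall (z : X) (e : R), 0 < e -> e <= Delta ->
  c * e `^ s <= mass mu (ball z e).
Hypothesis cube_ball : forall A, members D A -> exists (z : X) (e : R),
  [/\ 0 < e, e <= Delta, ball z e `<=` A & mass mu A <= Kc * e `^ s].
Hypothesis cube_diam : forall P y z, members D P -> P y -> P z ->
  mdist y z <= L * mass mu P `^ s^-1.
Variables (x : nat -> X) (r : nat -> R) (E : nat -> set X).
Hypothesis r0 : forall n, 0 < r n.
Hypothesis r_small : forall e : R, 0 < e ->
  exists n0, forall n, (n0 <= n)%N -> r n < e.
Hypothesis full : mu (lim_sup_set (fun n => ball (x n) (r n))) = 1%E.
Hypothesis E_sub : forall n, E n `<=` ball (x n) (r n).
Variables (u v K : R).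
Hypotheses (u0 : 0 < u) (uv : u < v) (u1 : u <= 1) (K0 : 0 < K).
Hypothesis local_content : forall n F, F `<=` members D ->
  E n `<=` \bigcup_(P in F) P ->
  ((mass mu (ball (x n) (r n)))%:E <= K%:E * family_weight mu v F)%E.

Lemma metric_ball_measurable (z : X) e : measurable (ball z e).
Proof. exact/open_measurable/metric_ball_open. Qed.

Let reach P := 3 * (L * mass mu P `^ s^-1).

Lemma reach_gt0 P : members D P -> 0 < reach P.
Proof.
by move=> DP; rewrite !mulr_gt0// powR_gt0// (member_mass_gt0 tree).
Qed.

Lemma mass_reach (P : set X) z : members D P ->
  mass mu (ball z (reach P)) <= C * (3 * L) `^ s * mass mu P.
Proof.
move=> DP; apply: le_trans (ball_upper z (reach_gt0 DP)) _.
have mP0 := member_mass_gt0 tree DP.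
have L3 : 0 <= 3 * L by rewrite mulr_ge0// ltW.
rewrite /reach mulrA (powRM _ L3 (powR_ge0 _ _)).
by rewrite -powRrM mulVf ?gt_eqF// (powRr1 (ltW mP0)) mulrA.
Qed.

(** If the cube P meets the n-th ball without staying in its double, the diameter
of P exceeds the radius r n; any ball around a point of P with three times the
diameter bound as radius then contains the n-th ball. *)
Lemma ball_in_reach (P : set X) n p p' z : members D P -> P p -> P p' -> P z ->
  ball (x n) (r n) p -> ~ ball (x n) (2 * r n) p' ->
  ball (x n) (r n) `<=` ball z (reach P).
Proof.
move=> DP Pp Pp' Pz; rewrite !ballEmdist /= => np /negP; rewrite -leNgt => np'.
move=> y /= ny; rewrite /reach.
have pp' := cube_diam DP Pp Pp'; have zp := cube_diam DP Pz Pp.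
have := metric_triangle (x n) p p'; have := metric_triangle z p y.
have := metric_triangle p (x n) y; rewrite (metric_sym p (x n)).
by set ell := L * _ in pp' zp *; lra.
Qed.

(** When the members of F meeting E n stay in the doubled ball, they have small
mass, and lowering the exponent from v to u gains a factor 1 / eps. *)
Lemma near_content (n : nat) (F : set (set X)) (eps : R) : 0 <= eps ->
  (C * (2 * r n) `^ s) `^ (v - u) <= eps ->
  F `<=` members D -> E n `<=` \bigcup_(P in F) P ->
  (forall P, meeting F (E n) P -> P `<=` ball (x n) (2 * r n)) ->
  ((mass mu (ball (x n) (r n)))%:E <=
   (K * eps)%:E * family_weight mu u (meeting F (E n)))%E.
Proof.
move=> eps0 small FD cov near.
have mD : meeting F (E n) `<=` members D by move=> P [/FD].
apply: le_trans (local_content mD _) _.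
  move=> y Ey; have [P FP Py] := cov _ Ey.
  by exists P => //; split=> //; exists y.
rewrite EFinM -muleA; apply: lee_wpmul2l; first by rewrite lee_fin ltW.
rewrite /family_weight -esumZl//; last by move=> P; rewrite lee_fin weight_ge0.
apply: le_esum => P mP; rewrite -EFinM lee_fin /weight.
have P0 := member_mass_gt0 tree (mD _ mP).
rewrite -[in leLHS](subrK u v) powRD; last by rewrite (gt_eqF P0) implybT.
apply: ler_wpM2r; first exact: powR_ge0.
apply: le_trans small; apply: ge0_ler_powR; rewrite ?subr_ge0 ?nnegrE ?mass_ge0//.
- exact: ltW.
- by rewrite mulr_ge0 ?powR_ge0// ltW.
have rn : 0 < 2 * r n by rewrite mulr_gt0.
apply: (le_trans _ (ball_upper (x n) rn)).
apply: le_mass (near _ mP) => //; last exact: metric_ball_measurable.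
exact: (member_measurable tree (mD _ mP)).
Qed.

Section OneCube.
Variables (A : set X) (F : set (set X)) (z : X) (e : R) (m : nat).
Hypotheses (DA : members D A) (e0 : 0 < e) (eA : ball z e `<=` A).
Hypothesis FD : F `<=` members D.
Hypothesis cov : inner_union E m A `<=` \bigcup_(P in F) P.
Hypothesis no_cover : forall Q, F Q -> ~ (A `<=` Q).
Hypotheses (r_e : forall n, (m <= n)%N -> 4 * r n < e)
  (r_Delta : forall n, (m <= n)%N -> r n <= Delta)
  (r_eps : forall n, (m <= n)%N ->
     (C * (2 * r n) `^ s) `^ (v - u) <= mass mu A `^ (1 - u)).

Let G := ball z (e / 2).
Let Ca := C * (3 * L) `^ s.
Let Cb := C * 5 `^ s / c.

Lemma ball_in_cube n : (m <= n)%N -> ball (x n) (r n) `&` G !=set0 ->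
  E n `<=` A.
Proof.
move=> mn [y []]; rewrite /G !ballEmdist /= => ny zy p /E_sub.
rewrite ballEmdist /= => np; apply: eA; rewrite ballEmdist /=.
have := metric_triangle z y p; have := metric_triangle y (x n) p.
by rewrite (metric_sym y (x n)); have := r_e mn; lra.
Qed.

(** An index n is near if the members of F meeting E n stay in the doubled ball.
The balls of the near indices are handled by Vitali's lemma and [near_content]:
the families of members of F that are used are disjoint because the doubled
balls are.  Each other ball lies in the enlargement of a member P of F inside
A, and mass P <= weight P * (mass A)^(1-u). *)
Lemma partial_mass_le (t : seq nat) : (forall n, n \in t -> (m <= n)%N) ->
  (mu (G `&` \bigcup_(n in [set` t]) ball (x n) (r n)) <=
   ((Ca + Cb * K) * mass mu A `^ (1 - u))%:E * family_weight mu u F)%E.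
Proof.
move=> tm.
have Fin P y n : (m <= n)%N -> E n `<=` A -> F P -> P y -> E n y -> P `<=` A.
  move=> mn EA FP Py Ey.
  have [//|AP] := members_comparable tree (FD FP) DA Py (EA _ Ey).
  by case: (no_cover FP).
pose near n := forall P, meeting F (E n) P -> P `<=` ball (x n) (2 * r n).
pose ok n := ball (x n) (r n) `&` G !=set0.
pose t' := [seq n <- t | `[< ok n /\ near n >]].
have t'P n : n \in t' -> [/\ (m <= n)%N, ok n & near n].
  by rewrite mem_filter => /andP[/asboolP[? ?] /tm].
have [I [It' Idis Icov]] := @vitali_finite _ _ x r t' r0.
(* A base point in each cube, as centre of its enlargement. *)
have [w wP] : {w : set X -> X & forall P, members D P -> P (w P)}.
  apply: (@choice _ _ (fun P y => members D P -> P y)) => P.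
  have [DP|nDP] := pselect (members D P); last by exists z.
  by have [y Py] := member_nonempty tree DP; exists y.
pose FA := F `&` [set P | P `<=` A].
have FAD : FA `<=` members D by move=> P [/FD].
pose U1 := \bigcup_(P in FA) ball (w P) (reach P).
pose U2 := \bigcup_(j in [set` I]) ball (x j) (5 * r j).
have mU1 : measurable U1.
  by apply/open_measurable/bigcup_open => P _; exact: metric_ball_open.
have mU2 : measurable U2.
  by apply/open_measurable/bigcup_open => P _; exact: metric_ball_open.
have sub : G `&` \bigcup_(n in [set` t]) ball (x n) (r n) `<=` U1 `|` U2.
  move=> y [Gy [n /= nt ny]].
  have okn : ok n by exists y.
  have mn := tm _ nt; have EA := ball_in_cube mn okn.
  have [nn|nnear] := pselect (near n).
    have [|j jI nj] := Icov n; first by rewrite mem_filter nt andbT; apply/asboolP.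
    by right; exists j => //; exact: nj.
  move: nnear => /existsNP[P /not_implyP[[FP [p [Pp Ep]]]]].
  move=> /existsNP[p' /not_implyP[Pp' np']].
  left; exists P; first by split=> //; exact: (Fin P p n).
  exact: (ball_in_reach (FD FP) Pp Pp' (wP _ (FD FP)) (E_sub Ep) np').
have mG : measurable (G `&` \bigcup_(n in [set` t]) ball (x n) (r n)).
  apply: open_measurable; apply: openI; first exact: metric_ball_open.
  by apply: bigcup_open => n _; exact: metric_ball_open.
apply: (@le_trans _ _ (mu U1 + mu U2)%E).
  apply: le_trans (measureU2 mu mU1 mU2).
  by rewrite le_measure ?inE//; exact: measurableU.
have W0 P : (0 <= (weight mu u P)%:E)%E by rewrite lee_fin weight_ge0.
have Wn0 : (0 <= family_weight mu u F)%E by exact: esum_ge0.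
have Ca0 : 0 <= Ca by apply: mulr_ge0; [exact: ltW|exact: powR_ge0].
have Cb0 : 0 <= Cb by rewrite /Cb !mulr_ge0 ?powR_ge0 ?invr_ge0// ltW.
have A0 := powR_ge0 (mass mu A) (1 - u).
have Ca_le P y : members D P -> mass mu (ball y (reach P)) <= Ca * mass mu P.
  exact: mass_reach.
have Cb_le j : (m <= j)%N ->
    mass mu (ball (x j) (5 * r j)) <= Cb * mass mu (ball (x j) (r j)).
  move=> mj; have rj := r0 j.
  apply: le_trans (ball_upper _ _) _; first by rewrite mulr_gt0.
  rewrite (powRM _ _ (ltW rj))// mulrA /Cb -[leRHS]mulrA.
  apply: ler_wpM2l; first by rewrite mulr_ge0 ?powR_ge0// ltW.
  by rewrite mulrC ler_pdivlMr// mulrC; apply: ball_lower => //; exact: r_Delta.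
clearbody Ca Cb.
have CbK : 0 <= Cb * K := mulr_ge0 Cb0 (ltW K0).
have CaA := mulr_ge0 Ca0 A0; have CbKA := mulr_ge0 CbK A0.
rewrite mulrDl EFinD ge0_muleDl ?lee_fin//; apply: leeD.
  have cFA : countable FA.
    by apply: sub_countable (members_countable tree); exact: subset_card_le.
  have h := @measure_le_esum _ _ _ mu _ FA _ U1 cFA
    (fun P _ => metric_ball_measurable (w P) (reach P)) mU1 (@subset_refl _ _).
  apply: le_trans h _; rewrite /family_weight -esumZl//.
  apply: (@le_trans _ _ (\esum_(P in FA)
      ((Ca * mass mu A `^ (1 - u))%:E * (weight mu u P)%:E))%E); last first.
    apply: esum_subset => [P|P []//].
    by rewrite mule_ge0// lee_fin.
  apply: le_esum => P [FP PA] /=.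
  rewrite (massE (metric_ball_measurable _ _)) -EFinM lee_fin.
  apply: le_trans (Ca_le _ _ (FD FP)) _; rewrite -mulrA.
  apply: ler_wpM2l => //; have P0 := member_mass_gt0 tree (FD FP).
  rewrite /weight -[in leLHS](powRr1 (ltW P0)) -[in leLHS](subrK u 1).
  rewrite powRD; last by rewrite (gt_eqF P0) implybT.
  apply: ler_wpM2r; first exact: powR_ge0.
  apply: ge0_ler_powR; rewrite ?subr_ge0 ?nnegrE ?mass_ge0//.
  by apply: le_mass => //; apply: (member_measurable tree) => //; exact: FD.
have h := @measure_le_esum _ _ _ mu _ [set` I] _ U2 (finite_set_countable (finite_seq I))
  (fun j _ => metric_ball_measurable (x j) (5 * r j)) mU2 (@subset_refl _ _).
apply: le_trans h _.
apply: (@le_trans _ _ (\esum_(j in [set` I]) ((Cb * (K * mass mu A `^ (1 - u)))%:E *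
   family_weight mu u (meeting F (E j))))%E).
  apply: le_esum => j /= /It'/t'P[mj okj nearj] /=.
  rewrite (massE (metric_ball_measurable _ _)).
  apply: (@le_trans _ _ (Cb * mass mu (ball (x j) (r j)))%:E).
    by rewrite lee_fin Cb_le.
  rewrite EFinM [in leRHS]EFinM -muleA; apply: lee_wpmul2l; first by rewrite lee_fin.
  apply: near_content => //; first exact: r_eps.
  by move=> y Ey; apply: cov; exists j => //; split=> //; exact: ball_in_cube.
rewrite mulrA.
rewrite esumZl//; last by move=> j; exact: esum_ge0.
apply: lee_wpmul2l; first by rewrite lee_fin.
apply: esum_disjoint_le => //; first by move=> j _ P [].
move=> i j P iI jI mi mj; have [_ _ neari] := t'P _ (It' _ iI).
have [_ _ nearj] := t'P _ (It' _ jI).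
have [y Py] := member_nonempty tree (FD (proj1 mi)).
exact: (Idis i j y iI jI (neari _ mi _ Py) (nearj _ mj _ Py)).
Qed.

(** The finite unions of balls in [partial_mass_le] increase to a set that contains
almost all of the ball G. *)
Lemma full_mass_le :
  (mu G <= ((Ca + Cb * K) * mass mu A `^ (1 - u))%:E * family_weight mu u F)%E.
Proof.
pose B n := ball (x n) (r n).
pose H k := G `&` \bigcup_(n in [set` index_iota m k]) B n.
have openH k : open (H k).
  apply: openI; first exact: metric_ball_open.
  by apply: bigcup_open => n _; exact: metric_ball_open.
have mlim : measurable (lim_sup_set B).
  apply: bigcapT_measurable => k; apply: bigcup_measurable => n _.
  exact: metric_ball_measurable.
have mG : measurable G := metric_ball_measurable _ _.
have GH : G `&` lim_sup_set B `<=` \bigcup_k H k.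
  move=> y [Gy /(_ m I)[n /= mn By]]; exists n.+1 => //; split=> //.
  by exists n => //=; rewrite mem_index_iota mn ltnSn.
have mH : measurable (\bigcup_k H k).
  by apply/open_measurable/bigcup_open => k _.
have muG : (mu G <= mu (\bigcup_k H k))%E.
  have null : mu (~` lim_sup_set B) = 0%E.
    by rewrite probability_setC// full subee.
  apply: (@le_trans _ _ (mu (G `&` lim_sup_set B) + mu (~` lim_sup_set B))%E).
    apply: le_trans (measureU2 mu _ _); [|exact: measurableI|exact: measurableC].
    rewrite le_measure ?inE//.
      by apply: measurableU; [exact: measurableI|exact: measurableC].
    by move=> y Gy; have [By|nBy] := pselect (lim_sup_set B y); [left|right].
  rewrite null adde0 le_measure ?inE//; exact: measurableI.
apply: le_trans muG _.
have cvgH : mu \o H @ \oo --> mu (\bigcup_k H k).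
  apply: nondecreasing_cvg_mu => //; first by move=> k; exact: open_measurable.
  move=> k l kl; apply/subsetPset => y [Gy [n /= nk By]]; split=> //.
  exists n => //=; move: nk; rewrite !mem_index_iota => /andP[-> nk].
  exact: leq_trans kl.
apply: (cvge_to_le cvgH); apply: nearW => k /=.
by apply: partial_mass_le => n; rewrite mem_index_iota => /andP[].
Qed.

End OneCube.

(** A cube A contains a ball of comparable mass, so that [full_mass_le] compares
mass A with (mass A)^(1-u) times the cost of F.  Indices n are discarded until
the radii are small in terms of A; this is harmless because the bound does not
depend on how many indices were discarded. *)
Lemma inner_union_content_bound (m : nat) :
  exists2 c1 : R, 0 < c1 & content_bound mu D u (inner_union E m) c1.
Proof.
pose M := C * (3 * L) `^ s + C * 5 `^ s / c * K.
have M0 : 0 < M.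
  by rewrite addr_gt0// !mulr_gt0 ?powR_gt0 ?invr_gt0// mulr_gt0.
pose k := c * 2^-1 `^ s / Kc.
have k0 : 0 < k by rewrite divr_gt0// mulr_gt0// powR_gt0.
exists (Num.min 1 (k / M)); first by rewrite lt_min ltr01 divr_gt0.
move=> A F DA FD cov.
have [[Q FQ AQ]|noQ] := pselect (exists2 Q, F Q & A `<=` Q).
  apply: le_trans (weight_le_family tree (ltW u0) FD DA FQ AQ).
  by rewrite lee_fin ler_piMl ?weight_ge0// ge_min lexx.
have A0 := member_mass_gt0 tree DA.
have [z [e [e0 eD eA mAe]]] := cube_ball DA.
set eps := mass mu A `^ (1 - u).
have eps0 : 0 < eps by rewrite powR_gt0.
(* The bound on r n that is equivalent to the condition in [near_content]. *)
pose tau := 2^-1 * (eps `^ (v - u)^-1 / C) `^ s^-1.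
have tau0 : 0 < tau by rewrite mulr_gt0// powR_gt0// divr_gt0// powR_gt0.
have min0 : 0 < Num.min (e / 4) (Num.min Delta tau).
  by rewrite !lt_min Delta0 tau0 divr_gt0.
have [n0 n0P] := r_small min0.
have {}n0P n : (maxn m n0 <= n)%N -> [/\ 4 * r n < e, r n <= Delta &
    (C * (2 * r n) `^ s) `^ (v - u) <= eps].
  rewrite geq_max => /andP[_ /n0P]; rewrite !lt_min => /and3P[r1 r2 r3].
  split; [lra|exact: ltW|].
  have vu0 : 0 < v - u by rewrite subr_gt0.
  rewrite -[leRHS](powRr1 (ltW eps0)) -[X in _ <= _ `^ X](mulVf (lt0r_neq0 vu0)) powRrM.
  apply: ge0_ler_powR; rewrite ?nnegrE ?powR_ge0//; first exact: ltW.
    by rewrite mulr_ge0 ?powR_ge0// ltW.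
  rewrite mulrC -ler_pdivlMr//.
  have h0 : 0 <= eps `^ (v - u)^-1 / C by rewrite divr_ge0 ?powR_ge0 ?ltW.
  rewrite -[leRHS](powRr1 h0) -[X in _ <= _ `^ X](mulVf (lt0r_neq0 s0)) powRrM.
  apply: ge0_ler_powR; rewrite ?nnegrE ?powR_ge0//; first exact: ltW.
    by rewrite mulr_ge0// ltW.
  by rewrite -ler_pdivlMl// ltW.
have cov' : inner_union E (maxn m n0) A `<=` \bigcup_(P in F) P.
  apply: subset_trans cov => y [n [/= mn EA] Ey]; exists n => //; split=> //.
  exact: leq_trans (leq_maxl _ _) mn.
have nc Q : F Q -> ~ (A `<=` Q) by move=> FQ AQ; apply: noQ; exists Q.
have main := full_mass_le DA eA FD cov' nc
  (fun n h => let: And3 a _ _ := n0P n h in a)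
  (fun n h => let: And3 _ a _ := n0P n h in a)
  (fun n h => let: And3 _ _ a := n0P n h in a).
have low : k * mass mu A <= mass mu (ball z (e / 2)).
  have e20 : 0 < e / 2 by rewrite divr_gt0.
  apply: (le_trans _ (ball_lower z e20 _)); last by rewrite ler_pdivrMr//; lra.
  rewrite (mulrC e) powRM ?(ltW e0)// /k.
  rewrite (_ : _ / Kc * _ = c * (2^-1 `^ s * (Kc^-1 * mass mu A))); last by ring.
  rewrite ler_pM2l// ler_pM2l ?powR_gt0// ler_pdivrMl//.
apply: (@le_trans _ _ (((M * eps)^-1)%:E * (k * mass mu A)%:E)%E).
  rewrite -EFinM lee_fin.
  have -> : mass mu A = weight mu u A * eps.
    rewrite /eps /weight -powRD; last by rewrite (gt_eqF A0) implybT.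
    by rewrite (_ : u + (1 - u) = 1) ?(powRr1 (ltW A0))//; ring.
  rewrite (_ : (M * eps)^-1 * _ = k / M * weight mu u A); last first.
    by field; rewrite !gt_eqF.
  by rewrite ler_wpM2r ?weight_ge0// ge_min lexx orbT.
rewrite lee_pdivrMl ?mulr_gt0//; apply: le_trans main.
by rewrite (massE (metric_ball_measurable _ _)) lee_fin.
Qed.

End LocalToGlobal.

(** * Ahlfors regular spaces *)

Section Regular.
Context {d : measure_display} {R : realType} {X : measurableMetricType d R}.
Context {mu : probability X R} {s : R}.
Hypothesis s0 : 0 < s.
Hypothesis X_borel : borel X.

Lemma borel_open (U : set X) : open U -> measurable U.
Proof. by move=> oU; rewrite X_borel; exact: sub_gen_smallest. Qed.

Lemma borel_cball (z : X) e : measurable (cball z e).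
Proof.
rewrite -[cball z e]setCK; apply/measurableC/borel_open.
exact/closed_openC/cball_closed.
Qed.

Lemma dist_le_diam (A : set X) y z : A y -> A z ->
  ((mdist y z)%:E <= diam A)%E.
Proof.
by move=> Ay Az; apply: ereal_sup_ubound; right; exists (y, z).
Qed.

Lemma diam_le (A : set X) (e : R) : 0 <= e ->
  (forall y z, A y -> A z -> mdist y z <= e) -> (diam A <= e%:E)%E.
Proof.
move=> e0 Ae; apply: ge_ereal_sup => _ [->|[[y z] [/= Ay Az] <-]].
  by rewrite lee_fin.
by rewrite lee_fin; exact: Ae.
Qed.

Lemma diam_ge0 (A : set X) : (0 <= diam A)%E.
Proof. by apply: ereal_sup_ubound; left. Qed.

(** An unbounded space would contain balls of mass larger than 1. *)
Lemma regular_diam_fin : X -> ahlfors_regular s mu ->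
  diam [set: X] \is a fin_num.
Proof.
move=> z [C [C1 reg]]; rewrite ge0_fin_numE ?diam_ge0// ltey; apply/eqP => dX.
have C0 : 0 < C := lt_le_trans ltr01 C1.
have r0 : 0 < (2 * C) `^ s^-1 by rewrite powR_gt0// mulr_gt0.
have := reg z _ r0; rewrite dX leey => /(_ isT) /andP[lo _].
have mb : measurable (ball z ((2 * C) `^ s^-1)).
  exact/borel_open/metric_ball_open.
have := le_trans lo (probability_le1 mu mb); rewrite lee_fin -powRrM.
rewrite mulVf ?gt_eqF// powRr1; last by rewrite mulr_ge0// ltW.
by rewrite mulrCA mulVf ?gt_eqF//; lra.
Qed.

Variable Delta : R.
Hypothesis Delta0 : 0 < Delta.
Hypothesis X_diam : diam [set: X] = Delta%:E.
Variable C : R.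
Hypothesis C1 : 1 <= C.
Hypothesis reg : forall (x : X) (r : R), 0 < r -> (r%:E <= diam [set: X])%E ->
  ((C^-1 * r `^ s)%:E <= mu (ball x r) <= (C * r `^ s)%:E)%E.

Let C0 : 0 < C := lt_le_trans ltr01 C1.
Let Cu := C + (Delta `^ s)^-1.

Let Cu0 : 0 < Cu.
Proof. by rewrite addr_gt0// invr_gt0 powR_gt0. Qed.

Lemma mdist_le_Delta (y z : X) : mdist y z <= Delta.
Proof. by rewrite -lee_fin -X_diam; exact: dist_le_diam. Qed.

(** Radii larger than the diameter are covered as well, since a probability is at
most 1. *)
Lemma regular_upper (z : X) (e : R) : 0 < e ->
  mass mu (ball z e) <= Cu * e `^ s.
Proof.
move=> e0; have mb : measurable (ball z e) by exact/borel_open/metric_ball_open.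
have es0 := powR_gt0 s e0; have Ds0 := powR_gt0 s Delta0.
have [eD|De] := leP e Delta.
  have := reg z e0; rewrite X_diam lee_fin => /(_ eD) /andP[_].
  rewrite (massE mb) lee_fin => /le_trans; apply.
  by rewrite ler_pM2r// /Cu lerDl invr_ge0 ltW.
apply: le_trans (mass_le1 mb) _; rewrite /Cu mulrDl.
apply: (@le_trans _ _ ((Delta `^ s)^-1 * e `^ s)).
  rewrite mulrC ler_pdivlMr// mul1r.
  by apply: ge0_ler_powR; rewrite ?nnegrE ltW.
by rewrite lerDr mulr_ge0// ltW.
Qed.

Lemma regular_lower (z : X) (e : R) : 0 < e -> e <= Delta ->
  C^-1 * e `^ s <= mass mu (ball z e).
Proof.
move=> e0 eD; have mb : measurable (ball z e).
  exact/borel_open/metric_ball_open.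
have := reg z e0; rewrite X_diam lee_fin => /(_ eD) /andP[+ _].
by rewrite (massE mb) lee_fin.
Qed.

Lemma ball_subset (z : X) (e e' : R) : e <= e' -> ball z e `<=` ball z e'.
Proof.
by move=> ee' y; rewrite !ballEmdist /= => /lt_le_trans; apply.
Qed.

Lemma open_mass_gt0 (U : set X) : open U -> U !=set0 -> 0 < mass mu U.
Proof.
move=> oU [y Uy]; have mU := borel_open oU.
have /nbhs_ballP[e /= e0 eU] : nbhs y U by exact: open_nbhs_nbhs.
pose e' := Num.min e Delta.
have e'0 : 0 < e' by rewrite lt_min e0.
apply: lt_le_trans (le_mass (P := ball y e') _ mU _).
- apply: lt_le_trans (regular_lower y e'0 _); last by rewrite ge_min lexx orbT.
  by rewrite mulr_gt0 ?invr_gt0// powR_gt0.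
- exact/borel_open/metric_ball_open.
- by apply: subset_trans eU; apply: ball_subset; rewrite ge_min lexx.
Qed.

Lemma powR_scale_lt (K e : R) : 0 < K -> 0 < e ->
  exists2 a : R, 0 < a & K * a `^ s < e.
Proof.
move=> K0 e0; exists ((e / (2 * K)) `^ s^-1).
  by rewrite powR_gt0// divr_gt0// mulr_gt0.
rewrite -powRrM mulVf ?gt_eqF// powRr1; last by rewrite divr_ge0 ?mulr_ge0 ?ltW.
rewrite (_ : K * _ = e / 2); last by field; rewrite gt_eqF.
by rewrite ltr_pdivrMr//; lra.
Qed.

(** For e > 0 the closed ball lies in the open ball of radius 2 e, and e^s <= e^t; for
e = 0 it is a point, of mass 0. *)
Lemma cball_mass_le (z : X) (e t : R) : 0 <= e -> e <= 1 -> 0 <= t -> t < s ->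
  mass mu (cball z e) <= Cu * 2 `^ s * e `^ t.
Proof.
move=> e0 e1 t0 ts; have mc := borel_cball z e.
have le_ball e' : e < e' -> mass mu (cball z e) <= Cu * e' `^ s.
  move=> ee'; apply: le_trans (regular_upper z (le_lt_trans e0 ee')).
  apply: le_mass => //; first exact/borel_open/metric_ball_open.
  by move=> y; rewrite /cball ballEmdist /= => /le_lt_trans; apply.
have [e_gt0|e_le0] := ltP 0 e.
  apply: le_trans (le_ball (2 * e) _) _; first lra.
  rewrite powRM// mulrA ler_wpM2l ?mulr_ge0 ?powR_ge0 ?(ltW Cu0)//.
  by apply: ger_powR; rewrite ?e_gt0// ltW.
have -> : mass mu (cball z e) = 0; last by rewrite !mulr_ge0 ?powR_ge0 ?(ltW Cu0).
apply/eqP; rewrite eq_le mass_ge0 andbT leNgt; apply/negP => m0.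
have [a a0 ka] := powR_scale_lt Cu0 m0.
by have := le_ball a (le_lt_trans e_le0 a0); rewrite leNgt ka.
Qed.

(** Mass distribution principle: a covering set U with diameter e <= 1 lies in a
closed ball of radius e, whose mass is at most a constant times e^t for t < s.
Sums over covers are thus bounded below by a positive constant. *)
Lemma hausdorff_dim_ge : (s%:E <= hausdorff_dim [set: X])%E.
Proof.
apply: le_ereal_inf_tmp => _ [t [t0 Ht] <-]; rewrite lee_fin leNgt.
apply/negP => ts.
pose K := Cu * 2 `^ s; have K0 : 0 < K by rewrite mulr_gt0// powR_gt0.
have : (hausdorff_premeasure t 1 [set: X] <= 0)%E.
  by rewrite -Ht; apply: ereal_sup_ubound; exists 1 => //=.
apply/negP; rewrite -ltNge; apply: (@lt_le_trans _ _ (K^-1)%:E).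
  by rewrite lte_fin invr_gt0.
apply: le_ereal_inf_tmp => _ [[J U] [/= dU cov] <-].
have [c cP] : {c : nat -> X & forall i, U i !=set0 -> U i (c i)}.
  apply: (@choice _ _ (fun i y => U i !=set0 -> U i y)) => i.
  have [[y Uy]|nU] := pselect (U i !=set0); first by exists y.
  by have [y _ _] := cov point I; exists point.
pose e i := fine (diam (U i)).
have eE i : J i -> diam (U i) = (e i)%:E.
  move=> Ji; rewrite fineK// ge0_fin_numE ?diam_ge0//.
  by apply: le_lt_trans (dU _ Ji) _; rewrite ltey.
rewrite -[leLHS]mule1 lee_pdivrMl// -esumZl; [|exact: ltW|by move=> i; exact: poweR_ge0].
rewrite -(@probability_setT _ _ _ mu).
have covc : [set: X] `<=` \bigcup_(i in J) cball (c i) (e i).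
  move=> y _; have [i Ji Uy] := cov y I; exists i => //; rewrite /cball /=.
  by rewrite -lee_fin -eE//; apply: dist_le_diam => //; apply: cP; exists y.
have h := @measure_le_esum _ _ _ mu _ J _ [set: X] (countableP J)
  (fun i _ => borel_cball (c i) (e i)) measurableT covc.
apply: le_trans h _; apply: le_esum => i Ji /=.
rewrite (massE (borel_cball _ _)) eE// poweR_EFin -EFinM lee_fin.
apply: cball_mass_le => //.
  by rewrite -lee_fin -eE// diam_ge0.
by rewrite -lee_fin -eE// dU.
Qed.

Lemma ball_mass_small (e : R) : 0 < e -> exists2 a : R, 0 < a &
  forall z r, 0 < r -> r < a -> mass mu (ball z r) < e.
Proof.
move=> e0; have [a a0 ka] := powR_scale_lt Cu0 e0; exists a => // z r r0 ra.
apply: le_lt_trans (regular_upper z r0) (le_lt_trans _ ka).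
by rewrite ler_pM2l//; apply: ge0_ler_powR; rewrite ?nnegrE ?ltW.
Qed.

(** The radius of a ball is not determined by the ball, but a ball of small
diameter has small mass and hence a small radius. *)
Lemma radius_small (x : nat -> X) (r : nat -> R) : (forall n, 0 < r n) ->
  (fun n : nat => diam (ball (x n) (r n))) @ \oo --> 0%E ->
  forall e : R, 0 < e -> exists n0, forall n, (n0 <= n)%N -> r n < e.
Proof.
move=> r0 lim e e0; pose e' := Num.min e Delta.
have e'0 : 0 < e' by rewrite lt_min e0.
have m0 : 0 < C^-1 * e' `^ s by rewrite mulr_gt0 ?invr_gt0// powR_gt0.
have [a a0 small] := ball_mass_small m0.
have a20 : 0 < a / 2 by rewrite divr_gt0.
have [n0 _ n0P] : \forall n \near \oo, (diam (ball (x n) (r n)) < (a / 2)%:E)%E.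
  have : nbhs 0%E [set y : \bar R | (y < (a / 2)%:E)%E].
    by apply: open_nbhs_nbhs; split; [exact: open_ereal_lt_ereal|rewrite /= lte_fin].
  exact: lim.
exists n0 => n /n0P dn; rewrite ltNge; apply/negP => ern.
have : mass mu (ball (x n) e') < C^-1 * e' `^ s.
  apply: le_lt_trans (small (x n) (a / 2) a20 _); last by rewrite ltr_pdivrMr//; lra.
  apply: le_mass; [exact/borel_open/metric_ball_open..|].
  move=> y ye'; rewrite ballEmdist /= -lte_fin; apply: le_lt_trans dn.
  apply: dist_le_diam; first by rewrite ballEmdist /= mdistxx.
  by apply: ball_subset ye'; rewrite ge_min ern.
by rewrite ltNge regular_lower// ge_min lexx orbT.
Qed.

End Regular.

(** * Generalized dyadic cubes *)

Definition cube_tree {X : Type} (N : int -> set nat)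
    (Q : int -> nat -> set X) (k : nat) : set (set X) :=
  if k is 0%N then [set setT] else Q k%:Z @` N k%:Z.

Lemma members_cube_tree {X : Type} (N : int -> set nat)
    (Q : int -> nat -> set X) : members (cube_tree N Q) = cube_family N Q.
Proof.
apply/seteqP; split=> P.
  move=> [[|k] _ /=]; first by move=> ->; left.
  by move=> [i Ni <-]; right; exists k.+1, i.
move=> [->|[[|k] [i [//= _ Ni ->]]]]; first by exists 0%N.
by exists k.+1 => //; exists i.
Qed.

Section Cubes.
Context {d : measure_display} {R : realType} {X : measurableMetricType d R}.
Context {mu : probability X R} {s : R}.
Hypothesis s0 : 0 < s.
Hypothesis X_borel : borel X.
Variables (Delta C : R).
Hypothesis Delta0 : 0 < Delta.
Hypothesis X_diam : diam [set: X] = Delta%:E.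
Hypothesis C1 : 1 <= C.
Hypothesis reg : forall (x : X) (r : R), 0 < r -> (r%:E <= diam [set: X])%E ->
  ((C^-1 * r `^ s)%:E <= mu (ball x r) <= (C * r `^ s)%:E)%E.
Variables (b : R) (N : int -> set nat) (Q : int -> nat -> set X)
  (ctr : int -> nat -> X).
Hypotheses (b0 : 0 < b) (b1 : b < 3^-1).
Hypothesis cubes : dyadic_cubes b N Q ctr.

Let D := cube_tree N Q.
Let C0 : 0 < C := lt_le_trans ltr01 C1.
Let Cu := C + (Delta `^ s)^-1.
Let inner := Num.min Delta (2^-1 - b / (1 - b)).
Let outer := Delta + (1 - b)^-1.
Let q := b `^ s.
Let m0 := C^-1 * inner `^ s.
Let m1 := Cu * (2 * outer) `^ s.

Let b_lt1 : b < 1. Proof. by apply: lt_trans b1 _; rewrite invf_lt1// ltr1n. Qed.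

Let inner0 : 0 < inner.
Proof.
rewrite lt_min Delta0 subr_gt0 ltr_pdivrMr ?subr_gt0//.
by move: b1; rewrite -[3^-1]div1r ltr_pdivlMr//; lra.
Qed.

Let outer0 : 0 < outer.
Proof. by rewrite addr_gt0// invr_gt0 subr_gt0. Qed.

Let Cu0 : 0 < Cu.
Proof. by rewrite addr_gt0// invr_gt0 powR_gt0. Qed.

Let bk0 k : 0 < b ^+ k. Proof. exact: exprn_gt0. Qed.

Let bk1 k : b ^+ k <= 1. Proof. by rewrite exprn_ile1 ?ltW. Qed.

Let powR_expr k : (b ^+ k) `^ s = q ^+ k.
Proof.
by rewrite -(powR_mulrn k (ltW b0)) -(powR_mulrn k (powR_ge0 b s)) powRAC.
Qed.

(** The constants are chosen so that the statement includes generation 0, where the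
only cube is the whole space: the inner radius is at most the diameter of X, the
range in which Ahlfors regularity bounds masses from below, and the outer one is
at least that diameter. *)
Lemma cube_tree_balls k P : D k P -> exists z : X,
  ball z (inner * b ^+ k) `<=` P /\ P `<=` cball z (outer * b ^+ k).
Proof.
case: k => [|k] /=.
  move=> ->; exists point; split=> // y _; rewrite /cball /= expr0 mulr1.
  apply: le_trans (mdist_le_Delta X_diam _ _) _.
  by rewrite lerDl invr_ge0 subr_ge0 ltW.
move=> [i Ni <-]; have [lo up] := cube_ball cubes Ni.
exists (ctr k.+1%:Z i); split.
  apply: subset_trans lo; apply: ball_subset; rewrite -exprnP ler_pM2r//.
  by rewrite ge_min lexx orbT.
apply: subset_trans up _ => y /le_trans; apply.
by rewrite -exprnP ler_pM2r// lerDr ltW.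
Qed.

Lemma cube_tree_measurable k P : D k P -> measurable P.
Proof.
by case: k => [->//|k [i Ni <-]]; exact: (cube_measurable cubes).
Qed.

Lemma cube_tree_lower k P : D k P -> m0 * q ^+ k <= mass mu P.
Proof.
move=> DP; have [z [zP _]] := cube_tree_balls DP.
apply: le_trans (le_mass _ (cube_tree_measurable DP) zP); last first.
  exact/(borel_open X_borel)/metric_ball_open.
apply: (le_trans _ (regular_lower X_borel X_diam reg z _ _)).
- by rewrite (powRM _ (ltW inner0) (ltW (bk0 k))) mulrA powR_expr.
- exact: mulr_gt0.
- by rewrite -[leRHS]mulr1 ler_pM ?(ltW inner0) ?(ltW (bk0 k))// ge_min lexx.
Qed.

Lemma cube_tree_upper k P : D k P -> mass mu P <= m1 * q ^+ k.
Proof.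
move=> DP; have [z [_ zP]] := cube_tree_balls DP.
have o2 : 0 < 2 * outer by rewrite mulr_gt0.
apply: (@le_trans _ _ (mass mu (ball z (2 * outer * b ^+ k)))).
  apply: le_mass; first exact: cube_tree_measurable DP.
    exact/(borel_open X_borel)/metric_ball_open.
  apply: subset_trans zP _ => y; rewrite /cball ballEmdist /= => /le_lt_trans; apply.
  by rewrite ltr_pM2r// ltr_pMl// ltr1n.
apply: le_trans (regular_upper s0 X_borel Delta0 X_diam C1 reg _ _) _.
  exact: mulr_gt0.
by rewrite (powRM _ (ltW o2) (ltW (bk0 k))) powR_expr mulrA.
Qed.

Lemma cube_mass_tree : mass_tree mu D q m0 m1.
Proof.
split.
- exact: powR_gt0.
- have one : (1 : R) `^ s = 1 by rewrite powR1.
  by rewrite /q -one gt0_ltr_powR// nnegrE ltW.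
- by rewrite mulr_gt0 ?invr_gt0// powR_gt0.
- by rewrite mulr_gt0// powR_gt0// mulr_gt0.
- exact: cube_tree_measurable.
- case=> [|k] /=; first exact/finite_set_countable/finite_set1.
  by apply: sub_countable (card_image_le _ _) _; exact: countableP.
- case=> [|k] y /=; first by exists setT.
  have : [set: X] y by [].
  rewrite -(cube_cover cubes k.+1%:Z) => -[i Ni Qy].
  by exists (Q k.+1%:Z i) => //; exists i.
- move=> [|k] [|l] P P' y //= lk; [by move=> -> ->|by move=> _ ->|].
  move=> [i Ni <-] [j Nj <-] Py P'y.
  have [disj|//] := cube_nested cubes (n := k.+1%:Z) (m := l.+1%:Z) lk Ni Nj.
  have : (set0 : set X) y by rewrite -disj.
  by [].
- exact: cube_tree_lower.
- exact: cube_tree_upper.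
Qed.

Let tree := cube_mass_tree.

Lemma cube_tree_dist k P y z : D k P -> P y -> P z ->
  mdist y z <= 2 * outer * b ^+ k.
Proof.
move=> /cube_tree_balls[c [_ Pc]] /Pc cy /Pc cz; rewrite /cball /= in cy cz.
have := metric_triangle y c z; rewrite (metric_sym y c); lra.
Qed.

Let L := 2 * outer / m0 `^ s^-1.

Lemma cube_dist_le_mass P y z : members D P -> P y -> P z ->
  mdist y z <= L * mass mu P `^ s^-1.
Proof.
move=> [k _ DP] Py Pz; apply: le_trans (cube_tree_dist DP Py Pz) _.
have m00 := tree_lower_gt0 tree.
rewrite /L -!mulrA ler_pM2l// ler_pM2l// ler_pdivlMl ?powR_gt0//.
have -> : b ^+ k = (q ^+ k) `^ s^-1.
  by rewrite -powR_expr -powRrM mulfV ?gt_eqF// powRr1// ltW.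
have qk0 : 0 <= q ^+ k by rewrite exprn_ge0// powR_ge0.
rewrite -powRM ?(ltW m00)//; apply: ge0_ler_powR.
- by rewrite invr_ge0 ltW.
- by rewrite nnegrE mulr_ge0// ltW.
- by rewrite nnegrE mass_ge0.
- exact: cube_tree_lower.
Qed.

Lemma cube_contains_ball P : members D P -> exists (z : X) (e : R),
  [/\ 0 < e, e <= Delta, ball z e `<=` P & mass mu P <= m1 / inner `^ s * e `^ s].
Proof.
move=> [k _ DP]; have [z [zP _]] := cube_tree_balls DP.
exists z, (inner * b ^+ k); split=> //; first exact: mulr_gt0.
  by rewrite -[leRHS]mulr1 ler_pM ?(ltW inner0) ?(ltW (bk0 k))// ge_min lexx.
apply: le_trans (cube_tree_upper DP) _.
rewrite (powRM _ (ltW inner0) (ltW (bk0 k))) powR_expr mulrA divfK//.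
by rewrite gt_eqF// powR_gt0.
Qed.

Lemma power_small (e : R) : 0 < e ->
  exists k0, forall k, (k0 <= k)%N -> 2 * outer * b ^+ k < e.
Proof.
move=> e0; have o2 : 0 < 2 * outer by rewrite mulr_gt0.
have /cvgrPdist_lt/(_ _ (divr_gt0 e0 o2))[k0 _ k0P] :
    (fun k => b ^+ k) @ \oo --> (0 : R).
  by apply: cvg_expr; rewrite gtr0_norm.
exists k0 => k /k0P /=; rewrite sub0r normrN gtr0_norm// => bk.
by rewrite mulrC -ltr_pdivlMr.
Qed.

Lemma cube_in_open (U : set X) y : open U -> U y ->
  exists P, [/\ members D P, P y & closure P `<=` U].
Proof.
move=> oU Uy; have /nbhs_ballP[e /= e0 eU] : nbhs y U by exact: open_nbhs_nbhs.
have [k /(_ k (leqnn k)) bk] := power_small e0.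
have [P DP Py] := tree_cover tree k y.
exists P; split=> //; first by exists k.
have [c [_ Pc]] := cube_tree_balls DP.
move=> w Pw; apply: eU; rewrite ballEmdist /=; apply: le_lt_trans bk.
have cy := Pc _ Py.
have cw : cball c (outer * b ^+ k) w by apply: closure_sub_cball; exact: closureS Pw.
rewrite /cball /= in cy cw.
have := metric_triangle y c w; rewrite (metric_sym y c); lra.
Qed.

(** The masses of the cubes of one generation sum to 1 and tend to 0 uniformly, so
that their powers of exponent v > 1 are small multiples of them. *)
Lemma generation_weight_small (v e : R) : 1 < v -> 0 < e ->
  exists k0, forall k, (k0 <= k)%N -> (family_weight mu v (D k) <= e%:E)%E.
Proof.
move=> v1 e0; have v10 : 0 < v - 1 by rewrite subr_gt0.
have a0 : 0 < e `^ (v - 1)^-1 by exact: powR_gt0.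
have [k0 k0P] := tree_mass_small tree a0; exists k0 => k k0k.
apply: (@le_trans _ _ (\esum_(P in D k) (e%:E * mu P))%E).
  apply: le_esum => P DP; have mP := cube_tree_measurable DP.
  rewrite (massE mP) -EFinM lee_fin /weight.
  rewrite -mulr_powRB1 ?mass_ge0 ?(lt_trans ltr01)// mulrC.
  apply: ler_wpM2r; first exact: mass_ge0.
  have lt := k0P _ _ k0k DP.
  rewrite -[leRHS](powRr1 (ltW e0)) -[X in _ <= _ `^ X](mulVf (lt0r_neq0 v10)) powRrM.
  by apply: ge0_ler_powR; rewrite ?nnegrE ?mass_ge0 ?powR_ge0// ltW.
rewrite esumZl ?(ltW e0)// -[leRHS]mule1; apply: lee_wpmul2l.
  by rewrite lee_fin ltW.
rewrite -(@probability_setT _ _ _ mu).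
apply: (@esum_measure_le _ _ _ _ _ _ id) => //.
  by move=> P; exact: cube_tree_measurable.
by move=> P P' y DP DP' Py P'y; exact: (tree_disjoint tree DP DP' Py P'y).
Qed.

(** It suffices to exhibit one exponent with zero Hausdorff measure, here 2 s, for
which the cost of generation k is of the order of the sum of the squares of the
masses.  Finiteness matters because the content is defined through the real
number attached to the dimension. *)
Lemma hausdorff_dim_fin : (hausdorff_dim [set: X] < +oo)%E.
Proof.
apply: (@le_lt_trans _ _ (s * 2)%:E); last by rewrite ltey.
apply: ereal_inf_lbound; exists (s * 2) => //; split; first by rewrite mulr_ge0// ltW.
pose K := L `^ (s * 2).
have pm0 := tree_lower_gt0 tree.
have L0 : 0 < L by rewrite divr_gt0 ?mulr_gt0// powR_gt0.
have K0 : 0 < K by exact: powR_gt0.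
have diamP k P : D k P -> (diam P <= (2 * outer * b ^+ k)%:E)%E.
  move=> DP; apply: diam_le; first by rewrite !mulr_ge0// ltW.
  by move=> y z; exact: cube_tree_dist.
have diam_w P : members D P -> ((diam P `^ (s * 2)) <= (K * weight mu 2 P)%:E)%E.
  move=> DP.
  have dP : (diam P <= (L * mass mu P `^ s^-1)%:E)%E.
    apply: diam_le; first by rewrite mulr_ge0 ?powR_ge0// ltW.
    by move=> y z; exact: cube_dist_le_mass.
  apply: (@le_trans _ _ ((L * mass mu P `^ s^-1)%:E `^ (s * 2))%E).
    apply: gt0_ler_poweR; rewrite ?mulr_ge0 ?(ltW s0)//.
    - by rewrite in_itv /= diam_ge0 leey.
    - by rewrite in_itv /= leey lee_fin mulr_ge0 ?powR_ge0// ltW.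
  rewrite poweR_EFin lee_fin (powRM _ (ltW L0) (powR_ge0 _ _)) -powRrM.
  by rewrite mulrA mulVf ?gt_eqF// mul1r.
apply/eqP; rewrite eq_le; apply/andP; split; last first.
  apply: le_trans (ereal_sup_ubound _); last by exists 1 => //=.
  apply: le_ereal_inf_tmp => _ [[J U] _ <-].
  by apply: esum_ge0 => i _; exact: poweR_ge0.
apply: ge_ereal_sup => _ [delta /= delta0 <-].
apply/lee_addgt0Pr => e e0; rewrite add0e.
have [k0 k0P] := generation_weight_small (ltr1n R 2) (divr_gt0 e0 K0).
have [k1 k1P] := power_small delta0.
pose k := (maxn k0 k1).+1.
have k0k : (k0 <= k)%N by rewrite leqW// leq_maxl.
have k1k : (k1 <= k)%N by rewrite leqW// leq_maxr.
have DQ i : N k%:Z i -> D k (Q k%:Z i) by move=> Ni; exists i.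
apply: (@le_trans _ _ (\esum_(i in N k%:Z) (diam (Q k%:Z i) `^ (s * 2)))%E).
  apply: ereal_inf_lbound; exists (N k%:Z, Q k%:Z) => //; split=> /= [i Ni|].
    apply: le_trans (diamP _ _ (DQ _ Ni)) _; rewrite lee_fin ltW//.
    exact: k1P.
  by rewrite (cube_cover cubes).
apply: (@le_trans _ _ (\esum_(i in N k%:Z) (K%:E * (weight mu 2 (Q k%:Z i))%:E))%E).
  by apply: le_esum => i Ni; rewrite -EFinM; apply: diam_w; exists k => //; exact: DQ.
rewrite esumZl ?(ltW K0)//; last by move=> i; rewrite lee_fin weight_ge0.
rewrite -lee_pdivlMl// -EFinM mulrC; apply: le_trans (k0P _ k0k).
rewrite /family_weight /= (esum_image _ _ (fun P => (weight mu 2 P)%:E))// => i j.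
move=> /set_mem Ni /set_mem Nj ij; apply: contrapT => nij.
have memi : members D (Q k%:Z i) by exists k => //; exact: DQ.
have [y Qy] := member_nonempty tree memi.
have := cube_disjoint cubes Ni Nj nij; rewrite -ij setIid => Q0.
by rewrite Q0 in Qy.
Qed.


Section Balls.
Variables (x : nat -> X) (r : nat -> R) (E : nat -> set X).
Hypothesis r0 : forall n, 0 < r n.
Hypothesis E_nonempty : forall n, E n !=set0.
Hypothesis E_open : forall n, open (E n).

(** The bound on the energy ratio turns [energy_cover] into a bound from which
mass (E n) cancels. *)
Lemma energy_local_content (t : R) : 0 <= t ->
  (ereal_sup (range (fun n => energy mu t (E n) * mu (ball (x n) (r n)) /
     (mu (E n) ^+ 2))) < +oo)%E ->
  exists2 K, 0 < K & forall n F, F `<=` members D ->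
    E n `<=` \bigcup_(P in F) P ->
    ((mass mu (ball (x n) (r n)))%:E <= K%:E * family_weight mu (t / s) F)%E.
Proof.
move=> t0 supfin.
have L0 : 0 < L.
  by rewrite divr_gt0 ?mulr_gt0// powR_gt0// (tree_lower_gt0 tree).
pose Kd := L `^ t; have Kd0 : 0 < Kd by exact: powR_gt0.
have dist_le P y z : members D P -> P y -> P z ->
    mdist y z `^ t <= Kd * weight mu (t / s) P.
  move=> DP Py Pz.
  apply: (@le_trans _ _ ((L * mass mu P `^ s^-1) `^ t)).
    apply: ge0_ler_powR => //; rewrite ?nnegrE.
    - exact: mdist_ge0.
    - by rewrite mulr_ge0 ?powR_ge0// ltW.
    - exact: cube_dist_le_mass.
  by rewrite (powRM _ (ltW L0) (powR_ge0 _ _)) -powRrM (mulrC s^-1).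
set S := ereal_sup _ in supfin.
(* The maximum with 1 keeps the energy bound positive if the supremum is 0. *)
pose Ke := Num.max 1 (fine S); have Ke0 : 0 < Ke by rewrite lt_max ltr01.
exists (Kd * Ke); first exact: mulr_gt0.
move=> n F FD cov.
have mE := borel_open X_borel (E_open n).
have mB : measurable (ball (x n) (r n)).
  exact/(borel_open X_borel)/metric_ball_open.
have E0 : 0 < mass mu (E n).
  exact: (open_mass_gt0 X_borel Delta0 X_diam C1 reg (E_open n) (E_nonempty n)).
have B0 : 0 < mass mu (ball (x n) (r n)).
  apply: (open_mass_gt0 X_borel Delta0 X_diam C1 reg); first exact: metric_ball_open.
  by exists (x n); exact: ballxx.
set e := mass mu (E n) in E0 *; set beta := mass mu _ in B0 *.
have en0 : (0 <= energy mu t (E n))%E.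
  apply: integral_ge0 => y _; apply: integral_ge0 => z _.
  by rewrite inve_ge0 lee_fin powR_ge0.
have quot : (energy mu t (E n) * (beta / e ^+ 2)%:E <= Ke%:E)%E.
  have : (energy mu t (E n) * mu (ball (x n) (r n)) / (mu (E n) ^+ 2) <= S)%E.
    by apply: ereal_sup_ubound; exists n.
  rewrite (massE mE) (massE mB) -/e -/beta -EFin_expe inver gt_eqF ?exprn_gt0//.
  rewrite -muleA -EFinM => le_S.
  apply: le_trans le_S _.
  have S0 : (0 <= S)%E.
    apply: le_trans (ereal_sup_ubound _); last by exists n.
    apply: mule_ge0; first by rewrite mule_ge0.
    by rewrite inve_ge0 expe_ge0.
  have Sfin : S \is a fin_num by rewrite ge0_fin_numE.
  by rewrite -(fineK Sfin) lee_fin le_max lexx orbT.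
have c0 : 0 < beta / e ^+ 2 by rewrite divr_gt0// exprn_gt0.
have enle : (energy mu t (E n) <= (Ke / (beta / e ^+ 2))%:E)%E.
  by rewrite EFinM lee_pdivlMr.
have I0 : 0 < Ke / (beta / e ^+ 2) by rewrite divr_gt0.
have := energy_cover tree Kd0 I0 dist_le mE enle FD cov.
rewrite -/e => main.
have -> : beta%:E = ((beta / e ^+ 2)%:E * (e ^+ 2)%:E)%E.
  by rewrite -EFinM divfK// gt_eqF// exprn_gt0.
apply: (@le_trans _ _ ((beta / e ^+ 2)%:E * ((Kd * (Ke / (beta / e ^+ 2)))%:E *
    family_weight mu (t / s) F))%E).
  by apply: lee_wpmul2l => //; rewrite lee_fin ltW.
rewrite muleA -EFinM (_ : _ * (Kd * _) = Kd * Ke)//.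
by field; rewrite !gt_eqF// exprn_gt0.
Qed.

(** For v > 1 the cubes of a late generation would cover at arbitrarily small
cost. *)
Lemma local_content_exponent_le1 (v K : R) : 0 < K ->
  (forall n F, F `<=` members D -> E n `<=` \bigcup_(P in F) P ->
    ((mass mu (ball (x n) (r n)))%:E <= K%:E * family_weight mu v F)%E) ->
  v <= 1.
Proof.
move=> K0 loc; rewrite leNgt; apply/negP => v1.
have B0 : 0 < mass mu (ball (x 0%N) (r 0%N)).
  apply: (open_mass_gt0 X_borel Delta0 X_diam C1 reg); first exact: metric_ball_open.
  by exists (x 0%N); exact: ballxx.
set beta := mass mu _ in B0.
have e0 : 0 < beta / (2 * K) by rewrite divr_gt0// mulr_gt0.
have [k /(_ k (leqnn k)) wk] := generation_weight_small v1 e0.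
have : (beta%:E <= K%:E * family_weight mu v (D k))%E.
  apply: loc => [P DP|y _]; first by exists k.
  by have [P DP Py] := tree_cover tree k y; exists P.
apply/negP; rewrite -ltNge; apply: (@le_lt_trans _ _ (K%:E * (beta / (2 * K))%:E)%E).
  by apply: lee_wpmul2l => //; rewrite lee_fin ltW.
rewrite -EFinM lte_fin (_ : K * _ = beta / 2); last by field; rewrite gt_eqF.
by rewrite ltr_pdivrMr//; lra.
Qed.

Hypothesis E_sub : forall n, E n `<=` ball (x n) (r n).
Hypothesis X_compact : compact [set: X].
Hypothesis r_small : (fun n => diam (ball (x n) (r n))) @ \oo --> 0%E.
Hypothesis full : mu (lim_sup_set (fun n => ball (x n) (r n))) = 1%E.

Lemma limsup_content (u t : R) (A : set X) (F : set (set X)) :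
  0 < u -> s * u < t ->
  (ereal_sup (range (fun n => energy mu t (E n) * mu (ball (x n) (r n)) /
     (mu (E n) ^+ 2))) < +oo)%E ->
  members D A -> F `<=` members D ->
  lim_sup_set E `&` A `<=` \bigcup_(P in F) P ->
  ((weight mu u A)%:E <= family_weight mu u F)%E.
Proof.
move=> u0 sut supfin DA FD cov.
have t0 : 0 <= t by apply/ltW/(le_lt_trans _ sut); rewrite mulr_ge0// ltW.
have [K K0 loc] := energy_local_content t0 supfin.
have v1 := local_content_exponent_le1 K0 loc.
have uv : u < t / s by rewrite ltr_pdivlMr// mulrC.
have u1 : u < 1 := lt_le_trans uv v1.
have rs := radius_small s0 X_borel Delta0 X_diam C1 reg r0 r_small.
have L0 : 0 < L.
  by rewrite divr_gt0 ?mulr_gt0// powR_gt0// (tree_lower_gt0 tree).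
have inn0 : 0 < m1 / inner `^ s.
  by rewrite divr_gt0 ?powR_gt0// (tree_upper_gt0 tree).
have Ci0 : 0 < C^-1 by rewrite invr_gt0.
have bound m : content_bound mu D u (inner_union E m) 1.
  have [c c0 cb] := inner_union_content_bound tree s0 Cu0 Ci0 Delta0 L0 inn0
    (borel_open X_borel) (regular_upper s0 X_borel Delta0 X_diam C1 reg)
    (regular_lower X_borel X_diam reg) cube_contains_ball cube_dist_le_mass
    r0 rs full E_sub u0 uv (ltW u1) K0 loc m.
  apply: (content_bound_improve tree u0 u1 _ _ c0 cb).
    by move=> A' y [n [_ EA] Ey]; exact: EA.
  move=> A' B' AB y [n [mn EA] Ey]; exists n => //; split=> //.
  exact: subset_trans AB.
apply: (limsup_weight_le tree (ltW u0) X_compact bound _ _ DA FD cov).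
  by move=> n y Ey; exact: cube_in_open.
move=> e e0.
have [a a0 small] := ball_mass_small s0 X_borel Delta0 X_diam C1 reg e0.
have [n0 n0P] := rs _ a0; exists n0 => n P nn DP PE.
apply: le_lt_trans (small (x n) _ (r0 n) (n0P n nn)).
apply: le_mass; first exact: (member_measurable tree).
  exact/(borel_open X_borel)/metric_ball_open.
by move=> y Py; exact: (E_sub (PE y Py)).
Qed.

End Balls.
End Cubes.

(** * The limsup set *)

Lemma limsup_Gdelta {T : topologicalType} (E : nat -> set T) :
  (forall n, open (E n)) -> Gdelta (lim_sup_set E).
Proof.
move=> Eo; exists (fun n => \bigcup_(j in [set j | (n <= j)%N]) E j) => // n.
by apply: bigcup_open => j _; exact: Eo.
Qed.

Theorem theorem1p1 (R : realType) (d : measure_display)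
    (X : measurableMetricType d R) (mu : probability X R) (s : R)
    (hs : 0 < s)
    (hborel : borel X)
    (hcompact : compact [set: X])
    (hreg : ahlfors_regular s mu)
    (b : R) (hb0 : 0 < b) (hb1 : b < 3^-1)
    (N : int -> set nat) (Q : int -> nat -> set X) (ctr : int -> nat -> X)
    (hQ : dyadic_cubes b N Q ctr)
    (x : nat -> X) (r : nat -> R) (hr : forall n, 0 < r n)
    (hdecr : nonincreasing_seq (fun n : nat => diam (ball (x n) (r n))))
    (hlim : (fun n : nat => diam (ball (x n) (r n))) @ \oo --> 0%E)
    (E : nat -> set X)
    (hE0 : forall n, E n !=set0)
    (hEopen : forall n, open (E n))
    (hEB : forall n, E n `<=` ball (x n) (r n))
    (hlambda : (0 < energy_exponent mu (fun n => ball (x n) (r n)) E)%E)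
    (hfull : mu (lim_sup_set (fun n => ball (x n) (r n))) = 1%E) :
  large_intersection mu (cube_family N Q)
    (energy_exponent mu (fun n => ball (x n) (r n)) E)
    (lim_sup_set E).
Proof.
split; first exact: limsup_Gdelta.
move=> t A t0 tlambda QA.
have [C [C1 reg]] := hreg.
have fin := regular_diam_fin hs hborel (x 0%N) hreg.
pose Delta := fine (diam [set: X]).
have X_diam : diam [set: X] = Delta%:E by rewrite fineK.
(* If X is a single point, Ahlfors regularity is void, but every nonempty set
   E n is X. *)
have [Delta0|Delta0] := leP Delta 0.
  have one_point (y z : X) : y = z.
    apply: mdist_positivity; apply/eqP; rewrite eq_le mdist_ge0 andbT.
    apply: le_trans Delta0; rewrite -lee_fin -X_diam.
    exact: dist_le_diam.
  congr (cube_content _ _ _ _); apply/seteqP; split=> [y []//|y Ay].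
  split=> // n _; exists n => //=.
  by have [w Ew] := hE0 n; rewrite (one_point y w).
have [t1 [t10 supfin] tt1] : exists2 t1, 0 <= t1 /\
    (ereal_sup (range (fun n : nat => energy mu t1 (E n) *
      mu (ball (x n) (r n)) / (mu (E n) ^+ 2))) < +oo)%E & t < t1.
  have [_ [t1 /= t1P <-]] := ereal_sup_gt tlambda.
  by rewrite lte_fin => tt1; exists t1.
have dim_ge := hausdorff_dim_ge hs hborel Delta0 X_diam C1 reg.
have dim_fin := hausdorff_dim_fin hs hborel Delta0 X_diam C1 reg hb0 hb1 hQ.
pose tau := fine (hausdorff_dim [set: X]).
have tauE : hausdorff_dim [set: X] = tau%:E.
  rewrite fineK// ge0_fin_numE//; apply: le_trans dim_ge.
  by rewrite lee_fin ltW.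
have s_tau : s <= tau by rewrite -lee_fin -tauE.
have tau0 : 0 < tau := lt_le_trans hs s_tau.
pose u := t / tau.
have u0 : 0 < u by rewrite divr_gt0.
have sut : s * u < t1.
  apply: le_lt_trans tt1; rewrite /u mulrCA ler_piMr ?(ltW t0)//.
  by rewrite ler_pdivrMr// mul1r.
have treeQ := members_cube_tree N Q.
have tree := cube_mass_tree hs hborel Delta0 X_diam C1 reg hb0 hb1 hQ.
have wE P : cube_family N Q P -> (mu P `^ u)%E = (weight mu u P)%:E.
  rewrite -treeQ => DP.
  by rewrite (massE (member_measurable tree DP)) poweR_EFin.
have DA : members (cube_tree N Q) A by rewrite treeQ.
apply/eqP; rewrite eq_le; apply/andP; split.
  apply: le_ereal_inf => _ [[J U] [/= UQ cov] <-]; exists (J, U) => //.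
  by split=> //; apply: subset_trans cov; exact: subIsetr.
apply: (@le_trans _ _ (weight mu u A)%:E).
  apply: ereal_inf_lbound; exists ([set 0%N], fun=> A) => /=.
    by split=> // y Ay; exists 0%N.
  by rewrite esum_set1 ?poweR_ge0// -/tau -/u wE.
apply: le_ereal_inf_tmp => _ [[J U] [/= UQ cov] <-].
rewrite -/tau -/u.
apply: (@le_trans _ _ (family_weight mu u (U @` J))).
  apply: (limsup_content hs hborel Delta0 X_diam C1 reg hb0 hb1 hQ hr hE0
    hEopen hEB hcompact hlim hfull u0 sut supfin DA).
    by rewrite treeQ => _ [i Ji <-]; exact: UQ.
  move=> y /cov[i Ji Uy]; exists (U i) => //; by exists i.
have w0 P : (0 <= (weight mu u P)%:E)%E by rewrite lee_fin weight_ge0.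
apply: le_trans (esum_image_le J U w0) _.
by apply: le_esum => i Ji; rewrite wE//; exact: UQ.
Qed.
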